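(* Let $(B,\Phi,\sqsubseteq)$ be an ultra strongly quasihereditary algebra with simple modules labelled as $\Phi=\{(i,j):1\le i\le n,\ 1\le j\le l_i\}$ as in the context. Then $Q_{i,l_i}\cong T(i,1)$ for each $i$, and for every $(i,j)\in\Phi$ there is a short exact sequence $0\to T(i,j+1)\to T(i,j)\to\nabla(i,j)\to0$, where $T(i,l_i+1):=0$. In particular, $Q_{i,l_i}$ has a chain of submodules $0=M_{l_i+1}\subset M_{l_i}\subset\cdots\subset M_1=Q_{i,l_i}$ with $M_j\cong T(i,j)$ and $M_j/M_{j+1}\cong\nabla(i,j)$ for $1\le j\le l_i$, and this is the unique filtration of $Q_{i,l_i}$ by submodules whose successive quotients are costandard modules.
   Context: All algebras are finite-dimensional over a field $K$, all modules finite-dimensional left modules. Let $B$ be an algebra whose simple modules $L_x$ are labelled by a poset $(\Phi,\sqsubseteq)$; $P_x$, $Q_x$ are the projective cover and injective hull of $L_x$. The standard module $\Delta(x)$ is the largest quotient of $P_x$ with all composition factors $L_y$, $y\sqsubseteq x$; the costandard $\nabla(x)$ is the largest submodule of $Q_x$ with all composition factors $L_y$, $y\sqsubseteq x$. $\mathcal{F}(\Delta)$, $\mathcal{F}(\nabla)$ are the categories of modules with a filtration whose successive quotients are standard, resp. costandard. $B$ is quasihereditary w.r.t. $(\Phi,\sqsubseteq)$ if the poset is adapted to $B$ (for every module with simple top $L_x$ and simple socle $L_y$, $x,y$ incomparable, some $L_z$ with $z\sqsupset x$ or $z\sqsupset y$ is a composition factor), $[\Delta(x):L_x]=1$, and all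 projectives lie in $\mathcal{F}(\Delta)$. $T(x)$ is the unique indecomposable module in $\mathcal{F}(\Delta)\cap\mathcal{F}(\nabla)$ with $L_x$ as composition factor of multiplicity one and all other composition factors $L_y$, $y\sqsubset x$. $B$ is ultra strongly quasihereditary if (A1) each $\operatorname{rad}\Delta(x)$ is zero or isomorphic to a standard module, and (A2) $Q_x\in\mathcal{F}(\Delta)$ whenever $\operatorname{rad}\Delta(x)=0$. For such $B$ the standard modules are uniserial and the labels can (and will) be written as $\Phi=\{(i,j):1\le i\le n,\ 1\le j\le l_i\}$ so that $\Delta(i,j)$ is uniserial with composition factors $L_{i,j},L_{i,j+1},\dots,L_{i,l_i}$ from top to socle; i.e. $\operatorname{rad}\Delta(i,j)\cong\Delta(i,j+1)$ for $j<l_i$ and $\Delta(i,l_i)=L_{i,l_i}$ is simple. The order $\sqsubseteq$ is the original one transported to these labels (it satisfies $(i,j+1)\sqsubset(i,j)$). *)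

(* Defs.v *)
(* Finite-dimensional modules over a finite-dimensional
   K-algebra B are represented concretely by matrices (row-vector convention):
   a module M of dimension d is given by matrices [fact M b : 'M_d] and
   b . v := v *m fact M b.  Submodules are row spaces (mxalgebra, %MS). *)
From HB Require Import structures.
From mathcomp Require Import all_boot all_order all_algebra all_field.
Unset Printing Implicit Defensive.
Import GRing.Theory.
Local Open Scope ring_scope.

Record fmod (K : fieldType) (B : falgType K) := FMod {
  fdim : nat;
  fact : B -> 'M[K]_fdim;
  fact_linear : forall (a : K) (x y : B), fact (a *: x + y) = a *: fact x + fact y;
  fact1 : fact 1 = 1%:M;
  (* (b*c).v = b.(c.v) in the row convention *)
  factM : forall x y : B, fact (x * y) = fact y *m fact x }.
Arguments fmod {K} B.
Arguments FMod {K B}.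
Arguments fdim {K B}.
Arguments fact {K B}.
Arguments fact_linear {K B}.
Arguments fact1 {K B}.
Arguments factM {K B}.

Definition lab := (nat * nat)%type.
Definition inPhi (n : nat) (l : nat -> nat) : pred lab :=
  fun x => (1 <= x.1 <= n)%N && (1 <= x.2 <= l x.1)%N.

Definition poset_on (Phi : pred lab) (le : rel lab) :=
  [/\ forall x, Phi x -> le x x,
      forall x y, Phi x -> Phi y -> le x y -> le y x -> x = y &
      forall x y z, Phi x -> Phi y -> Phi z -> le x y -> le y z -> le x z].

Definition ltl (le : rel lab) : rel lab := fun x y => le x y && (x != y).

Definition is_hom {K : fieldType} {B : falgType K} {M N : fmod B}
  (f : 'M[K]_(fdim M, fdim N)) := forall b, fact M b *m f = f *m fact N b.

Definition is_submod {K : fieldType} {B : falgType K} {M : fmod B} {m : nat}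
  (U : 'M[K]_(m, fdim M)) := forall b, (U *m fact M b <= U)%MS.

(* the subquotient U/V of M (V <= U submodules) is isomorphic to N *)
Definition sq_iso {K : fieldType} {B : falgType K} (M : fmod B) {m1 m2 : nat}
  (U : 'M[K]_(m1, fdim M)) (V : 'M[K]_(m2, fdim M)) (N : fmod B) :=
  [/\ is_submod U, is_submod V, (V <= U)%MS &
   exists f : 'M[K]_(fdim M, fdim N),
     [/\ forall b, U *m (fact M b *m f - f *m fact N b) = 0,
         V *m f = 0,
         \rank (U *m f) = fdim N &
         \rank U = (\rank V + fdim N)%N]].

Definition iso {K : fieldType} {B : falgType K} (M N : fmod B) :=
  sq_iso M (1%:M : 'M[K]_(fdim M)) (0 : 'M[K]_(fdim M)) N.

Definition simple_sec {K : fieldType} {B : falgType K} (M : fmod B) {m1 m2 : nat}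
  (U : 'M[K]_(m1, fdim M)) (V : 'M[K]_(m2, fdim M)) :=
  [/\ is_submod U, is_submod V, (V < U)%MS &
      forall W : 'M[K]_(fdim M), is_submod W -> (V <= W)%MS -> (W <= U)%MS ->
        (W == V)%MS \/ (W == U)%MS].

Definition simple_mod {K : fieldType} {B : falgType K} (M : fmod B) :=
  simple_sec M (1%:M : 'M[K]_(fdim M)) (0 : 'M[K]_(fdim M)).

Definition simples_labelled {K : fieldType} {B : falgType K}
  (L : lab -> fmod B) (Phi : pred lab) :=
  [/\ forall x, Phi x -> simple_mod (L x),
      forall x y, Phi x -> Phi y -> iso (L x) (L y) -> x = y &
      forall S : fmod B, simple_mod S -> exists2 x, Phi x & iso S (L x)].

Definition secfactors {K : fieldType} {B : falgType K} (L : lab -> fmod B)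
  (P : pred lab) {M : fmod B} {m1 m2 : nat}
  (U : 'M[K]_(m1, fdim M)) (V : 'M[K]_(m2, fdim M)) :=
  forall U' V' : 'M[K]_(fdim M), (V <= V')%MS -> (U' <= U)%MS ->
    simple_sec M U' V' -> exists2 y, P y & sq_iso M U' V' (L y).

Definition factors_in {K : fieldType} {B : falgType K} (L : lab -> fmod B)
  (P : pred lab) (M : fmod B) :=
  secfactors L P (1%:M : 'M[K]_(fdim M)) (0 : 'M[K]_(fdim M)).

Definition is_cf {K : fieldType} {B : falgType K} (M S : fmod B) :=
  exists U V : 'M[K]_(fdim M), simple_sec M U V /\ sq_iso M U V S.

Definition compseries {K : fieldType} {B : falgType K} (M : fmod B) (k : nat)
  (c : nat -> 'M[K]_(fdim M)) :=
  [/\ c 0%N = 1%:M, c k = 0 & forall j, (j < k)%N -> simple_sec M (c j) (c j.+1)].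

(* multiplicity [M : S] = m, computed along some composition series
   (well defined by Jordan-Hoelder) *)
Definition mult {K : fieldType} {B : falgType K} (M S : fmod B) (m : nat) :=
  exists k (c : nat -> 'M[K]_(fdim M)) (A : {set 'I_k}),
    [/\ compseries M k c,
        forall j : 'I_k, j \in A <-> sq_iso M (c j) (c j.+1) S &
        #|A| = m].

Definition filt_by {K : fieldType} {B : falgType K} (C : fmod B -> Prop)
  (M : fmod B) :=
  exists k (c : nat -> 'M[K]_(fdim M)),
    [/\ c 0%N = 1%:M, c k = 0 &
        forall j, (j < k)%N -> exists2 N, C N & sq_iso M (c j) (c j.+1) N].

Definition projective {K : fieldType} {B : falgType K} (P : fmod B) :=
  forall (X Y : fmod B) (g : 'M[K]_(fdim X, fdim Y)) (h : 'M[K]_(fdim P, fdim Y)),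
    is_hom g -> row_full g -> is_hom h ->
    exists h' : 'M[K]_(fdim P, fdim X), is_hom h' /\ h' *m g = h.

Definition injective {K : fieldType} {B : falgType K} (Q : fmod B) :=
  forall (X Y : fmod B) (g : 'M[K]_(fdim X, fdim Y)) (h : 'M[K]_(fdim X, fdim Q)),
    is_hom g -> row_free g -> is_hom h ->
    exists h' : 'M[K]_(fdim Y, fdim Q), is_hom h' /\ g *m h' = h.

Definition projcover {K : fieldType} {B : falgType K} (L : lab -> fmod B)
  (x : lab) (P : fmod B) :=
  projective P /\
  exists V : 'M[K]_(fdim P),
    sq_iso P (1%:M : 'M[K]_(fdim P)) V (L x) /\
    forall U : 'M[K]_(fdim P), is_submod U -> (U + V == 1%:M)%MS -> (U == 1%:M)%MS.

Definition injhull {K : fieldType} {B : falgType K} (L : lab -> fmod B)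
  (x : lab) (Q : fmod B) :=
  injective Q /\
  exists W : 'M[K]_(fdim Q),
    sq_iso Q W (0 : 'M[K]_(fdim Q)) (L x) /\
    forall U : 'M[K]_(fdim Q), is_submod U -> \rank U != 0%N ->
      \rank (U :&: W)%MS != 0%N.

Definition below (Phi : pred lab) (le : rel lab) (x : lab) : pred lab :=
  fun y => Phi y && le y x.

Definition standard {K : fieldType} {B : falgType K} (L : lab -> fmod B)
  (Phi : pred lab) (le : rel lab) (x : lab) (N : fmod B) :=
  exists P, projcover L x P /\
  exists V : 'M[K]_(fdim P),
    [/\ sq_iso P (1%:M : 'M[K]_(fdim P)) V N,
        secfactors L (below Phi le x) (1%:M : 'M[K]_(fdim P)) V &
        forall V' : 'M[K]_(fdim P), is_submod V' ->
          secfactors L (below Phi le x) (1%:M : 'M[K]_(fdim P)) V' ->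
          (V <= V')%MS].

Definition costandard {K : fieldType} {B : falgType K} (L : lab -> fmod B)
  (Phi : pred lab) (le : rel lab) (x : lab) (N : fmod B) :=
  exists Q, injhull L x Q /\
  exists U : 'M[K]_(fdim Q),
    [/\ sq_iso Q U (0 : 'M[K]_(fdim Q)) N,
        secfactors L (below Phi le x) U (0 : 'M[K]_(fdim Q)) &
        forall U' : 'M[K]_(fdim Q), is_submod U' ->
          secfactors L (below Phi le x) U' (0 : 'M[K]_(fdim Q)) ->
          (U' <= U)%MS].

Definition FDelta {K : fieldType} {B : falgType K} (L : lab -> fmod B)
  (Phi : pred lab) (le : rel lab) (M : fmod B) :=
  filt_by (fun N => exists2 y, Phi y & standard L Phi le y N) M.

Definition FNabla {K : fieldType} {B : falgType K} (L : lab -> fmod B)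
  (Phi : pred lab) (le : rel lab) (M : fmod B) :=
  filt_by (fun N => exists2 y, Phi y & costandard L Phi le y N) M.

Definition indecomposable {K : fieldType} {B : falgType K} (M : fmod B) :=
  (0 < fdim M)%N /\
  forall U V : 'M[K]_(fdim M), is_submod U -> is_submod V ->
    (U + V == 1%:M)%MS -> \rank (U :&: V)%MS = 0%N -> \rank U = 0%N \/ \rank V = 0%N.

Definition tilting {K : fieldType} {B : falgType K} (L : lab -> fmod B)
  (Phi : pred lab) (le : rel lab) (x : lab) (T : fmod B) :=
  [/\ FDelta L Phi le T, FNabla L Phi le T, indecomposable T,
      mult T (L x) 1 &
      factors_in L (fun y => Phi y && ((y == x) || ltl le y x)) T].

Definition simple_top {K : fieldType} {B : falgType K} (L : lab -> fmod B)
  (x : lab) (M : fmod B) :=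
  exists V : 'M[K]_(fdim M),
    sq_iso M (1%:M : 'M[K]_(fdim M)) V (L x) /\
    forall U : 'M[K]_(fdim M), is_submod U -> (U < 1%:M)%MS -> (U <= V)%MS.

Definition simple_socle {K : fieldType} {B : falgType K} (L : lab -> fmod B)
  (y : lab) (M : fmod B) :=
  exists S : 'M[K]_(fdim M),
    sq_iso M S (0 : 'M[K]_(fdim M)) (L y) /\
    forall U : 'M[K]_(fdim M), is_submod U -> \rank U != 0%N -> (S <= U)%MS.

Definition adapted {K : fieldType} {B : falgType K} (L : lab -> fmod B)
  (Phi : pred lab) (le : rel lab) :=
  forall (M : fmod B) x y, Phi x -> Phi y -> ~~ le x y -> ~~ le y x ->
    simple_top L x M -> simple_socle L y M ->
    exists z, [/\ Phi z, ltl le x z || ltl le y z & is_cf M (L z)].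

Definition quasihereditary {K : fieldType} {B : falgType K} (L : lab -> fmod B)
  (Phi : pred lab) (le : rel lab) :=
  [/\ adapted L Phi le,
      forall x (N : fmod B), Phi x -> standard L Phi le x N -> mult N (L x) 1 &
      forall P : fmod B, projective P -> FDelta L Phi le P].

Definition is_rad {K : fieldType} {B : falgType K} {M : fmod B}
  (R : 'M[K]_(fdim M)) :=
  [/\ is_submod R,
      forall U : 'M[K]_(fdim M), simple_sec M (1%:M : 'M[K]_(fdim M)) U -> (R <= U)%MS &
      forall v : 'rV[K]_(fdim M),
        (forall U : 'M[K]_(fdim M), simple_sec M (1%:M : 'M[K]_(fdim M)) U -> (v <= U)%MS) ->
        (v <= R)%MS].

Definition ultra_strongly_qh {K : fieldType} {B : falgType K} (L : lab -> fmod B)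
  (Phi : pred lab) (le : rel lab) :=
  [/\ quasihereditary L Phi le,
      forall x (N : fmod B) (R : 'M[K]_(fdim N)), Phi x -> standard L Phi le x N ->
        is_rad R ->
        \rank R = 0%N \/
        exists y (N' : fmod B), [/\ Phi y, standard L Phi le y N' &
                                   sq_iso N R (0 : 'M[K]_(fdim N)) N'] &
      forall x (N : fmod B) (R : 'M[K]_(fdim N)) (Q : fmod B), Phi x ->
        standard L Phi le x N -> is_rad R -> \rank R = 0%N ->
        injhull L x Q -> FDelta L Phi le Q].

(* Main.v *)
Require Import Defs.
From HB Require Import structures.
From mathcomp Require Import all_boot all_order all_algebra all_field.
From Stdlib Require Import Classical IndefiniteDescription.
Import GRing.Theory VectorInternalTheory.

(** Let Q be the injective hull of L_(i,l_i).  By (A2) it lies in F(Delta), and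
    F(Delta) is closed under submodules, because the nonzero submodules of the
    uniserial Delta(i,j) are again standard.  Hence any nonzero map from
    Delta(z) to Q is injective, z = (i,k) for some k, and its image depends
    only on z.  Let M_j be the largest submodule of Q whose composition factors
    are labelled by elements below (i,j).  By downward induction on j, M_(j+1)
    lies in F(nabla).  Since Ext^1(F(Delta), F(nabla)) = 0, maps from modules
    in F(Delta) to Q/M_(j+1) lift to Q.  This shows that Q/M_(j+1) is injective,
    and that its simple submodules, being images of lifted maps Delta(z) -> Q
    that do not land in M_(j+1), all coincide with one copy of L_(i,j).  So
    Q/M_(j+1) is the injective hull of L_(i,j), and M_j/M_(j+1) is nabla(i,j).
    The same lifting applied to Q/M_1 gives M_1 = Q.  In an arbitrary
    filtration with costandard quotients, read from the bottom, the socle of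
    the next quotient embeds into Q/M_(j+1), so that quotient is nabla(i,j)
    and the next submodule is M_j. *)

(** * Homomorphisms and exact sequences *)

(** That M_j is T(i,j) means that it has the defining properties, and these come from the same
    facts: M_j is in F(Delta) as a submodule of Q and in F(nabla) by the downward induction; it is
    indecomposable because each of its nonzero submodules contains the socle of Q; and
    [M_j : L_(i,j)] = 1 because all nonzero maps Delta(i,j) -> M_j share one image.

    Everything is phrased through homomorphisms. The composition factors of M are read off from maps
    P_y -> M out of projective covers; conditions on labels then pass to submodules, quotients and
    extensions at once. Vanishing of Ext^1 is the statement that maps defined on the kernel of P_x
    -> Delta(x) extend to P_x. Standard and costandard modules are given only by predicates, so two
    of them with the same label are compared by a lifted map and a dimension count.

    Adaptedness enters only in the Ext^1 statement. (A1) makes submodules of standard modules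
    standard, and (A2) is applied only to the simple module Delta(i,l_i). *)

Section Homs.
Local Open Scope ring_scope.
Set Implicit Arguments.
Unset Strict Implicit.
Variables (K : fieldType) (B : falgType K).
Implicit Types (M N X Y S C : fmod B).

Lemma hom_comp X Y M (f : 'M[K]_(fdim X, fdim Y)) (g : 'M[K]_(fdim Y, fdim M)) :
  is_hom f -> is_hom g -> is_hom (f *m g).
Proof. by move=> hf hg b; rewrite mulmxA hf -mulmxA hg mulmxA. Qed.

Lemma hom_add X Y (f g : 'M[K]_(fdim X, fdim Y)) :
  is_hom f -> is_hom g -> is_hom (f + g).
Proof. by move=> hf hg b; rewrite mulmxDr hf hg mulmxDl. Qed.

Lemma hom_sub X Y (f g : 'M[K]_(fdim X, fdim Y)) :
  is_hom f -> is_hom g -> is_hom (f - g).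
Proof. by move=> hf hg b; rewrite mulmxBr hf hg mulmxBl. Qed.

Lemma hom_1 X : is_hom (1%:M : 'M[K]_(fdim X)).
Proof. by move=> b; rewrite mulmx1 mul1mx. Qed.

Lemma hom_0 X Y : is_hom (0 : 'M[K]_(fdim X, fdim Y)).
Proof. by move=> b; rewrite mulmx0 mul0mx. Qed.

Lemma hom_cancelr X Y M (f : 'M[K]_(fdim X, fdim Y)) (g : 'M[K]_(fdim Y, fdim M)) :
  is_hom (f *m g) -> is_hom g -> row_free g -> is_hom f.
Proof.
move=> hfg hg fg b; apply: (row_free_inj fg) => /=.
by rewrite -[LHS]mulmxA hfg -!mulmxA hg.
Qed.

Lemma row_full_inj m n p (g : 'M[K]_(m, n)) (u v : 'M[K]_(n, p)) :
  row_full g -> g *m u = g *m v -> u = v.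
Proof. by move=> /mulVpmx gK e; rewrite -[u]mul1mx -[v]mul1mx -gK -!mulmxA e. Qed.

Lemma hom_cancell X Y M (f : 'M[K]_(fdim X, fdim Y)) (g : 'M[K]_(fdim Y, fdim M)) :
  is_hom (f *m g) -> is_hom f -> row_full f -> is_hom g.
Proof.
by move=> hfg hf ff b; apply: (row_full_inj ff); rewrite mulmxA -hf -mulmxA hfg mulmxA.
Qed.

Lemma ker_submod X Y (f : 'M[K]_(fdim X, fdim Y)) : is_hom f -> is_submod (kermx f).
Proof. by move=> hf b; apply/sub_kermxP; rewrite -mulmxA hf mulmxA mulmx_ker mul0mx. Qed.

Lemma img_submod X Y m (U : 'M[K]_(m, fdim X)) (f : 'M[K]_(fdim X, fdim Y)) :
  is_hom f -> is_submod U -> is_submod (U *m f).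
Proof. by move=> hf hU b; rewrite -mulmxA -hf mulmxA submxMr. Qed.

Lemma hom_submod X Y (f : 'M[K]_(fdim X, fdim Y)) : is_hom f -> is_submod f.
Proof. by move=> hf b; rewrite -hf submxMl. Qed.

Lemma submod1 X : is_submod (1%:M : 'M[K]_(fdim X)).
Proof. by move=> b; rewrite submx1. Qed.

Lemma submod0 X m : is_submod (0 : 'M[K]_(m, fdim X)).
Proof. by move=> b; rewrite mul0mx sub0mx. Qed.

Lemma submod_eqmx X m p (U : 'M[K]_(m, fdim X)) (V : 'M[K]_(p, fdim X)) :
  (U :=: V)%MS -> is_submod U -> is_submod V.
Proof. by move=> e hU b; rewrite -e -(eqmxMr (fact X b) e). Qed.

Lemma submod_add X m p (U : 'M[K]_(m, fdim X)) (V : 'M[K]_(p, fdim X)) :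
  is_submod U -> is_submod V -> is_submod (U + V)%MS.
Proof. by move=> hU hV b; rewrite addsmxMr addsmxS. Qed.

Lemma submod_cap X m p (U : 'M[K]_(m, fdim X)) (V : 'M[K]_(p, fdim X)) :
  is_submod U -> is_submod V -> is_submod (U :&: V)%MS.
Proof.
move=> hU hV b; rewrite sub_capmx.
by rewrite (submx_trans (submxMr _ (capmxSl _ _)) (hU b))
           (submx_trans (submxMr _ (capmxSr _ _)) (hV b)).
Qed.

(** The cokernel of V kills exactly V, so [kermx (f *m cokermx V)] serves as the preimage of V under
    f. *)
Lemma sub_preim m n p q (A : 'M[K]_(m, n)) (f : 'M[K]_(n, p)) (V : 'M[K]_(q, p)) :
  (A <= kermx (f *m cokermx V))%MS = (A *m f <= V)%MS.
Proof. by rewrite sub_kermx mulmxA -submxE. Qed.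

Lemma preim_submod X Y q (f : 'M[K]_(fdim X, fdim Y)) (V : 'M[K]_(q, fdim Y)) :
  is_hom f -> is_submod V -> is_submod (kermx (f *m cokermx V)).
Proof.
move=> hf hV b; rewrite sub_preim -mulmxA hf mulmxA.
apply: submx_trans (hV b); apply: submxMr.
by rewrite -sub_preim.
Qed.

(** On a row basis g of U, with right inverse p, an element b acts by g b p. Stability of U gives g
    b p g = g b, which makes this action multiplicative. *)
Lemma sub_exists M m (U : 'M[K]_(m, fdim M)) : is_submod U ->
  exists S (g : 'M[K]_(fdim S, fdim M)), [/\ is_hom g, row_free g & (g :=: U)%MS].
Proof.
move=> hU; set g := row_base U; set p := pinvmx g.
have gp : g *m p = 1%:M by apply: mulmxVp; exact: row_base_free.
have hb b : g *m fact M b *m p *m g = g *m fact M b.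
  apply: mulmxKpV; rewrite !eq_row_base.
  by rewrite (eqmxMr _ (eq_row_base U)); exact: hU.
have fg : row_free g by exact: row_base_free.
have eg : (g :=: U)%MS by exact: eq_row_base.
clearbody p; clearbody g.
have lin a x y : g *m fact M (a *: x + y) *m p =
    a *: (g *m fact M x *m p) + g *m fact M y *m p.
  by rewrite fact_linear mulmxDr mulmxDl -scalemxAr -scalemxAl.
have one : g *m fact M 1 *m p = 1%:M by rewrite fact1 mulmx1.
have mul x y : g *m fact M (x * y) *m p = (g *m fact M y *m p) *m (g *m fact M x *m p).
  by rewrite factM !mulmxA hb.
exists (FMod (\rank U) (fun b => g *m fact M b *m p) lin one mul), g; split.
- by move=> b /=; rewrite hb.
- exact: fg.
- exact: eg.
Qed.

(** Dually, p is a coordinate map onto the cokernel and s a section of it. The action s b p is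
    compatible with p because p s - 1 has image in V, which is stable under b. *)
Lemma quo_exists M m (V : 'M[K]_(m, fdim M)) : is_submod V ->
  exists C (p : 'M[K]_(fdim M, fdim C)), [/\ is_hom p, row_full p & (kermx p :=: V)%MS].
Proof.
move=> hV; set p := col_base (cokermx V); set s := pinvmx p.
have fp : row_full p by exact: col_base_full.
have sp : s *m p = 1%:M by apply: mulVpmx.
have ker q (A : 'M[K]_(q, fdim M)) : (A *m p == 0) = (A <= V)%MS.
  rewrite submxE -(@mulmx_free_eq0 _ _ _ _ _ (row_base (cokermx V))) ?row_base_free //.
  by rewrite -mulmxA mulmx_base.
have hb b : p *m (s *m fact M b *m p) = fact M b *m p.
  have e : p *m (s *m fact M b *m p) - fact M b *m p = (p *m s - 1%:M) *m fact M b *m p.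
    by rewrite !mulmxBl mul1mx !mulmxA.
  apply/eqP; rewrite -subr_eq0 e ker.
  apply: submx_trans (hV b); apply: submxMr.
  by rewrite -ker mulmxBl -mulmxA sp mulmx1 mul1mx subrr.
clearbody s; clearbody p.
have lin a x y : s *m fact M (a *: x + y) *m p =
    a *: (s *m fact M x *m p) + s *m fact M y *m p.
  by rewrite fact_linear mulmxDr mulmxDl -scalemxAr -scalemxAl.
have one : s *m fact M 1 *m p = 1%:M by rewrite fact1 mulmx1.
have mul x y : s *m fact M (x * y) *m p = (s *m fact M y *m p) *m (s *m fact M x *m p).
  by rewrite factM -(mulmxA (s *m fact M y)) hb !mulmxA.
exists (FMod (\rank (cokermx V)) (fun b => s *m fact M b *m p) lin one mul), p; split.
- by move=> b /=; rewrite hb.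
- exact: fp.
- by apply/eqmxP; rewrite -ker mulmx_ker eqxx sub_kermx ker submx_refl.
Qed.

Lemma factor_mono S M X (g : 'M[K]_(fdim S, fdim M)) (f : 'M[K]_(fdim X, fdim M)) :
  is_hom g -> row_free g -> is_hom f -> (f <= g)%MS ->
  exists2 h : 'M[K]_(fdim X, fdim S), is_hom h & h *m g = f.
Proof.
move=> hg fg hf /submxP [h e]; exists h => //.
by apply: (hom_cancelr _ hg fg); rewrite -e.
Qed.

Lemma factor_lin m n p (f : 'M[K]_(m, n)) (g : 'M[K]_(m, p)) :
  kermx f *m g = 0 -> exists h : 'M[K]_(n, p), f *m h = g.
Proof.
move=> k; exists (pinvmx f *m g); apply/eqP; rewrite mulmxA -subr_eq0.
rewrite -{2}[g]mul1mx -mulmxBl.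
have /submxP [u ->] : (f *m pinvmx f - 1%:M <= kermx f)%MS.
  by rewrite sub_kermx mulmxBl mulmxKpV // mul1mx subrr.
by rewrite -mulmxA k mulmx0.
Qed.

Lemma factor_epi M C X (p : 'M[K]_(fdim M, fdim C)) (f : 'M[K]_(fdim M, fdim X)) :
  is_hom p -> row_full p -> is_hom f -> kermx p *m f = 0 ->
  exists2 h : 'M[K]_(fdim C, fdim X), is_hom h & p *m h = f.
Proof.
move=> hp fp hf k; have [h e] := factor_lin k; exists h => //.
by apply: (hom_cancell _ hp fp); rewrite e.
Qed.

Lemma kermx_sub_mul0 m n p q (f : 'M[K]_(m, n)) (A : 'M[K]_(p, m)) (g : 'M[K]_(m, q)) :
  (kermx f <= A)%MS -> A *m g = 0 -> kermx f *m g = 0.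
Proof. by move=> /submxP[u ->] e; rewrite -mulmxA e mulmx0. Qed.

Lemma image_factor X Y (f : 'M[K]_(fdim X, fdim Y)) : is_hom f ->
  exists I (q : 'M[K]_(fdim X, fdim I)) (m : 'M[K]_(fdim I, fdim Y)),
    [/\ is_hom q, row_full q, is_hom m, row_free m & q *m m = f].
Proof.
move=> hf; have [I [m [hm fm em]]] := sub_exists (hom_submod hf).
have [|q hq eq] := factor_mono hm fm hf; first by rewrite em.
exists I, q, m; split=> //.
by rewrite /row_full -(mxrankMfree q fm) eq -em -/(row_free m) fm.
Qed.

Lemma ker_exists X Y (f : 'M[K]_(fdim X, fdim Y)) : is_hom f ->
  exists S (k : 'M[K]_(fdim S, fdim X)), [/\ is_hom k, row_free k & (k :=: kermx f)%MS].
Proof. by move=> hf; apply: sub_exists; exact: ker_submod. Qed.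

Definition exact3 X M N (f : 'M[K]_(fdim X, fdim M)) (p : 'M[K]_(fdim M, fdim N)) :=
  [/\ is_hom f, row_free f, is_hom p, row_full p & (f :=: kermx p)%MS].

Lemma exact_comp0 X M N (f : 'M[K]_(fdim X, fdim M)) (p : 'M[K]_(fdim M, fdim N)) :
  exact3 f p -> f *m p = 0.
Proof. by move=> [_ _ _ _ e]; apply/eqP; rewrite -sub_kermx e. Qed.

Lemma exact_dim X M N (f : 'M[K]_(fdim X, fdim M)) (p : 'M[K]_(fdim M, fdim N)) :
  exact3 f p -> fdim M = (fdim X + fdim N)%N.
Proof.
move=> [_ /eqP rf _ /eqP rp e]; have := mxrank_ker p.
by rewrite -e rf rp => ->; rewrite subnK // -rp rank_leq_row.
Qed.

Lemma exact_lift X M N (f : 'M[K]_(fdim X, fdim M)) (p : 'M[K]_(fdim M, fdim N))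
  Y (g : 'M[K]_(fdim Y, fdim M)) :
  exact3 f p -> is_hom g -> g *m p = 0 ->
  exists2 h : 'M[K]_(fdim Y, fdim X), is_hom h & h *m f = g.
Proof.
by move=> [hf ff hp _ e] hg g0; apply: factor_mono => //; rewrite e sub_kermx g0.
Qed.

Lemma exact_desc X M N (f : 'M[K]_(fdim X, fdim M)) (p : 'M[K]_(fdim M, fdim N))
  Y (g : 'M[K]_(fdim M, fdim Y)) :
  exact3 f p -> is_hom g -> f *m g = 0 ->
  exists2 h : 'M[K]_(fdim N, fdim Y), is_hom h & p *m h = g.
Proof.
move=> [hf ff hp fp e] hg g0; apply: factor_epi => //.
by apply: (@kermx_sub_mul0 _ _ _ _ p f) => //; rewrite e.
Qed.

Lemma exact_of_epi M N (p : 'M[K]_(fdim M, fdim N)) : is_hom p -> row_full p ->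
  exists X (f : 'M[K]_(fdim X, fdim M)), exact3 f p.
Proof. by move=> hp fp; have [X [f [? ? ?]]] := ker_exists hp; exists X, f. Qed.

(** The matrix f in [sq_iso] respects the action only on U. Restricted to a module S representing U
    it becomes a genuine homomorphism, so subquotients can be treated by exact sequences. *)
Lemma sq_isoP M m1 m2 (U : 'M[K]_(m1, fdim M)) (V : 'M[K]_(m2, fdim M)) N
  S (g : 'M[K]_(fdim S, fdim M)) :
  sq_iso M U V N -> is_hom g -> row_free g -> (g :=: U)%MS ->
  exists q : 'M[K]_(fdim S, fdim N), [/\ is_hom q, row_full q & (kermx q *m g :=: V)%MS].
Proof.
move=> [hU hV VU [f [lin V0 rk dim]]] hg fg eg; exists (g *m f).
have hq : is_hom (g *m f).
  move=> b; apply/eqP; rewrite -subr_eq0.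
  have -> : fact S b *m (g *m f) - g *m f *m fact N b
          = g *m (fact M b *m f - f *m fact N b).
    by rewrite mulmxBr !mulmxA hg.
  by move: (eg) => /eqmxP/andP[/submxP[u ->] _]; rewrite -mulmxA lin mulmx0.
have fq : row_full (g *m f) by rewrite /row_full (eqmxMr f eg) rk.
split=> //; apply: eqmx_sym; apply/eqmxP; rewrite -mxrank_leqif_eq.
  rewrite mxrankMfree // mxrank_ker (eqP fq) -(eqP fg) eg dim addnK //.
have /submxP[v ev] : (V <= g)%MS by rewrite eg.
rewrite ev; apply: submxMr; rewrite sub_kermx mulmxA -ev V0 //.
Qed.

Lemma sq_iso_intro M m1 m2 (U : 'M[K]_(m1, fdim M)) (V : 'M[K]_(m2, fdim M)) N
  S (g : 'M[K]_(fdim S, fdim M)) (q : 'M[K]_(fdim S, fdim N)) :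
  is_hom g -> row_free g -> (g :=: U)%MS ->
  is_hom q -> row_full q -> (kermx q *m g :=: V)%MS -> sq_iso M U V N.
Proof.
move=> hg fg eg hq fq ev.
have gU : is_submod U by apply: (submod_eqmx eg) => //; exact: hom_submod.
have gV : is_submod V.
  by apply: (submod_eqmx ev); apply: img_submod => //; exact: ker_submod.
have VU : (V <= U)%MS by rewrite -ev -eg submxMl.
(* Any linear extension r of q to all of M will do, since [sq_iso] tests it on U alone. *)
have [r gq] : exists r, g *m r = q.
  by exists (pinvmx g *m q); rewrite mulmxA mulmxVp ?mul1mx.
split=> //; exists r.
have [u eu] : exists u, U = u *m g by apply/submxP; rewrite eg.
have [v ev'] : exists v, V = v *m (kermx q *m g) by apply/submxP; rewrite ev.
split.
- move=> b.
  have -> : U *m (fact M b *m r - r *m fact N b)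
          = u *m (g *m fact M b *m r - g *m r *m fact N b).
    by rewrite eu !mulmxBr !mulmxA.
  by rewrite -hg -mulmxA gq hq subrr mulmx0.
- by rewrite ev' -mulmxA -(mulmxA (kermx q)) gq mulmx_ker mulmx0.
- by rewrite -(eqmxMr _ eg) gq; apply/eqP.
- rewrite -ev -eg mxrankMfree // mxrank_ker (eqP fq) (eqP fg) subnK //.
  by rewrite -(eqP fq) rank_leq_row.
Qed.

End Homs.

(** * Simple modules and filtrations *)

Section Simples.
Local Open Scope ring_scope.
Set Implicit Arguments.
Unset Strict Implicit.
Variables (K : fieldType) (B : falgType K).
Implicit Types (M N X Y S C : fmod B).

Lemma simple_modP S : simple_mod S ->
  (0 < fdim S)%N /\ forall m (W : 'M[K]_(m, fdim S)), is_submod W -> W != 0 -> row_full W.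
Proof.
move=> [_ _ lt H]; split.
  by move: lt; rewrite ltmxErank mxrank0 mxrank1 => /andP [].
move=> m W hW W0.
have hW' : is_submod <<W>>%MS by apply: (submod_eqmx _ hW); apply: eqmx_sym; exact: genmxE.
have [||/eqmxP e|/eqmxP e] := H _ hW'; rewrite ?sub0mx ?submx1 //.
  by move: W0; rewrite -mxrank_eq0 -(genmxE W) e mxrank0.
by rewrite /row_full -(genmxE W) e mxrank1.
Qed.

Lemma simple_mod_intro S : (0 < fdim S)%N ->
  (forall W : 'M[K]_(fdim S), is_submod W -> W != 0 -> row_full W) -> simple_mod S.
Proof.
move=> d0 H; split; [exact: submod1 | exact: submod0 | |].
  by rewrite ltmxErank sub0mx mxrank0 mxrank1.
move=> W hW _ _; case: (eqVneq W 0) => [->|W0]; first by left; rewrite submx_refl.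
by right; rewrite submx1 sub1mx H.
Qed.

Lemma simple_mono S X (f : 'M[K]_(fdim S, fdim X)) :
  simple_mod S -> is_hom f -> f != 0 -> row_free f.
Proof.
move=> /simple_modP [_ H] hf f0; rewrite -kermx_eq0.
apply: contraNT f0 => k0; apply/eqP.
by apply: (row_full_inj (H _ _ (ker_submod hf) k0)); rewrite mulmx_ker mulmx0.
Qed.

Lemma simple_epi S X (f : 'M[K]_(fdim X, fdim S)) :
  simple_mod S -> is_hom f -> f != 0 -> row_full f.
Proof. by move=> /simple_modP [_ H] hf; apply: H; exact: hom_submod. Qed.

Lemma row_full_neq0 m n (f : 'M[K]_(m, n)) : (0 < n)%N -> row_full f -> f != 0.
Proof. by move=> n0 /eqP e; rewrite -mxrank_eq0 e -lt0n. Qed.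

Lemma row_free_neq0 m n (f : 'M[K]_(m, n)) : (0 < m)%N -> row_free f -> f != 0.
Proof. by move=> n0 /eqP e; rewrite -mxrank_eq0 e -lt0n. Qed.

Lemma row_free_mul m n p (f : 'M[K]_(m, n)) (g : 'M[K]_(n, p)) :
  row_free f -> row_free g -> row_free (f *m g).
Proof. by move=> ff fg; rewrite /row_free mxrankMfree. Qed.

Lemma row_full_mul m n p (f : 'M[K]_(m, n)) (g : 'M[K]_(n, p)) :
  row_full f -> row_full g -> row_full (f *m g).
Proof. by move=> ff fg; rewrite /row_full (eqmxMfull _ ff). Qed.

Lemma row_full_mulr m n p (f : 'M[K]_(m, n)) (g : 'M[K]_(n, p)) :
  row_full (f *m g) -> row_full g.
Proof. by rewrite -!sub1mx => /submx_trans; apply; exact: submxMl. Qed.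

Lemma row_free_mull m n p (f : 'M[K]_(m, n)) (g : 'M[K]_(n, p)) :
  row_free (f *m g) -> row_free f.
Proof.
move=> /eqP e; rewrite /row_free eqn_leq rank_leq_row /= -{1}e.
exact: mxrankM_maxl.
Qed.

Lemma sq_iso_top M m (V : 'M[K]_(m, fdim M)) N : sq_iso M (1%:M : 'M[K]_(fdim M)) V N ->
  exists q : 'M[K]_(fdim M, fdim N), [/\ is_hom q, row_full q & (kermx q :=: V)%MS].
Proof.
move=> H.
have [|q [hq fq e]] := sq_isoP H (@hom_1 _ _ _) _ (eqmx_refl _).
  by rewrite /row_free mxrank1.
by exists q; rewrite mulmx1 in e.
Qed.

Lemma sq_iso_top_intro M m (V : 'M[K]_(m, fdim M)) N (q : 'M[K]_(fdim M, fdim N)) :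
  is_hom q -> row_full q -> (kermx q :=: V)%MS -> sq_iso M (1%:M : 'M[K]_(fdim M)) V N.
Proof.
move=> hq fq e; apply: (sq_iso_intro (@hom_1 _ _ _) _ (eqmx_refl _) hq fq).
  by rewrite /row_free mxrank1.
by rewrite mulmx1.
Qed.

Lemma sq_iso_bot M m p (U : 'M[K]_(m, fdim M)) N : sq_iso M U (0 : 'M[K]_(p, fdim M)) N ->
  exists s : 'M[K]_(fdim N, fdim M), [/\ is_hom s, row_free s & (s :=: U)%MS].
Proof.
move=> H; have hU : is_submod U by case: H.
have [S [g [hg fg eg]]] := sub_exists hU.
have [q [hq fq e]] := sq_isoP H hg fg eg.
have k0 : kermx q = 0 by apply/eqP; rewrite -mxrank_eq0 -(mxrankMfree _ fg) e mxrank0.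
have [s hs qs] : exists2 s, is_hom s & q *m s = g.
  by apply: factor_epi => //; rewrite k0 mul0mx.
have es : (s :=: g)%MS by rewrite -qs; apply: eqmx_sym; exact: eqmxMfull.
exists s; split=> //; last exact: eqmx_trans es eg.
have fq' : row_free q by rewrite -kermx_eq0 k0.
by rewrite /row_free es (eqP fg) -(eqP fq') (eqP fq).
Qed.

Lemma sq_iso_bot_intro M m p (U : 'M[K]_(m, fdim M)) N (s : 'M[K]_(fdim N, fdim M)) :
  is_hom s -> row_free s -> (s :=: U)%MS -> sq_iso M U (0 : 'M[K]_(p, fdim M)) N.
Proof.
move=> hs fs e; apply: (sq_iso_intro hs fs e (@hom_1 _ _ _)).
  by rewrite /row_full mxrank1.
have -> : kermx (1%:M : 'M[K]_(fdim N)) = 0.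
  by apply/eqP; rewrite kermx_eq0 /row_free mxrank1.
by rewrite mul0mx; apply/eqmxP; rewrite !sub0mx.
Qed.

Lemma isoP M N : iso M N ->
  exists f : 'M[K]_(fdim M, fdim N), [/\ is_hom f, row_free f & row_full f].
Proof.
move=> /sq_iso_top [q [hq fq e]]; exists q; split=> //.
by rewrite -kermx_eq0 -mxrank_eq0 e mxrank0.
Qed.

Lemma iso_intro M N (f : 'M[K]_(fdim M, fdim N)) :
  is_hom f -> row_free f -> row_full f -> iso M N.
Proof.
move=> hf ff fu; apply: (sq_iso_top_intro hf fu).
by move: ff; rewrite -kermx_eq0 => /eqP ->; exact: eqmx_refl.
Qed.

Lemma iso_inv M N (f : 'M[K]_(fdim M, fdim N)) :
  is_hom f -> row_free f -> row_full f ->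
  exists g : 'M[K]_(fdim N, fdim M),
    [/\ is_hom g, f *m g = 1%:M, g *m f = 1%:M, row_free g & row_full g].
Proof.
move=> hf ff fu.
have [|g hg fg] := factor_epi hf fu (@hom_1 _ _ M).
  by move: ff; rewrite -kermx_eq0 => /eqP ->; rewrite mul0mx.
have gf : g *m f = 1%:M by apply: (row_full_inj fu); rewrite mulmxA fg mul1mx mulmx1.
exists g; split=> //.
  by apply: (@row_free_mull _ _ _ g f); rewrite gf /row_free mxrank1.
by apply: (@row_full_mulr _ _ _ f g); rewrite fg /row_full mxrank1.
Qed.

Lemma simple_sec_quo M m1 m2 (U : 'M[K]_(m1, fdim M)) (V : 'M[K]_(m2, fdim M)) :
  simple_sec M U V -> exists C, simple_mod C /\ sq_iso M U V C.
Proof.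
move=> [hU hV VU H].
have [S [g [hg fg eg]]] := sub_exists hU.
have [v ev] : exists v, V = v *m g by apply/submxP; rewrite eg; exact: ltmxW.
have hv : is_submod v.
  by move=> b; rewrite -(submxMfree _ _ fg) -mulmxA hg mulmxA -ev; exact: hV.
have [C [q [hq fq eq]]] := quo_exists hv.
have ekg : (kermx q *m g :=: V)%MS by rewrite ev; exact: eqmxMr.
exists C; split; last exact: (sq_iso_intro hg fg eg hq fq).
apply: simple_mod_intro.
  case: (posnP (fdim C)) => // d0.
  have : (\rank V < \rank U)%N by move: VU; rewrite ltmxErank => /andP [].
  rewrite -ekg -eg mxrankMfree // mxrank_ker (eqP fq) d0 subn0.
  by rewrite (eqP fg) ltnn.
move=> W hW W0.
set W1 := kermx (q *m cokermx W).
have hW1 : is_submod W1 by exact: preim_submod.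
have hW2 : is_submod <<W1 *m g>>%MS.
  by apply: (submod_eqmx _ (img_submod hg hW1)); apply: eqmx_sym; exact: genmxE.
have [w ew] : exists w, W = w *m q by apply/submxP; exact: submx_full.
case: (H _ hW2).
- rewrite genmxE ev; apply: submxMr.
  rewrite sub_preim.
  have -> : v *m q = 0 by apply/eqP; rewrite -sub_kermx eq.
  exact: sub0mx.
- by rewrite genmxE -eg submxMl.
- move=> /andP [+ _]; rewrite genmxE ev submxMfree // => le.
  have : (w <= W1)%MS by rewrite sub_preim -ew.
  by move=> /submx_trans/(_ le); rewrite -eq sub_kermx -ew (negPf W0).
move=> /andP [_]; rewrite genmxE -eg => le.
have : (1%:M <= W1)%MS by rewrite -(submxMfree _ _ fg) mul1mx.
rewrite sub_preim mul1mx -sub1mx => /(submx_trans _); apply.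
by rewrite sub1mx.
Qed.

(** A submodule W between V and U is either killed by q, hence equal to V, or maps onto the simple
    C; in the latter case it also contains the kernel of q and is all of U. *)
Lemma simple_sec_intro M m1 m2 (U : 'M[K]_(m1, fdim M)) (V : 'M[K]_(m2, fdim M)) C :
  simple_mod C -> sq_iso M U V C -> simple_sec M U V.
Proof.
move=> /simple_modP [d0 sC] sq.
have [hU hV VU [_ [_ _ _ dim]]] := sq.
have [S [g [hg fg eg]]] := sub_exists hU.
have [q [hq fq ek]] := sq_isoP sq hg fg eg.
split=> //; first by rewrite ltmxErank VU dim -addn1 leq_add2l.
move=> W hW VW WU.
have [w ew] : exists w, W = w *m g by apply/submxP; rewrite eg.
have hw : is_submod w.
  by move=> b; rewrite -(submxMfree _ _ fg) -mulmxA hg mulmxA -ew; exact: hW.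
case: (eqVneq (w *m q) 0) => [e0|n0].
  left; rewrite VW andbT -ek ew; apply: submxMr; rewrite sub_kermx e0 //.
right; rewrite WU -eg ew -{1}[g]mul1mx submxMfree //.
have /submxP [u eu] : (q <= w *m q)%MS by apply: submx_full; exact: sC (img_submod hq hw) n0.
have kw : (kermx q <= w)%MS by rewrite -(submxMfree _ _ fg) ek -ew.
have -> : 1%:M = (1%:M - u *m w) + u *m w by rewrite subrK.
apply: addmx_sub; last exact: submxMl.
apply: submx_trans kw; rewrite sub_kermx mulmxBl mul1mx -mulmxA -eu subrr //.
Qed.

Lemma simple_sub_exists M : (0 < fdim M)%N ->
  exists S (s : 'M[K]_(fdim S, fdim M)), [/\ simple_mod S, is_hom s & row_free s].
Proof.
move: {2}(fdim M) (leqnn (fdim M)) => n; elim: n M => [|n IH] M le d0.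
  by move: d0; rewrite ltnNge le.
case: (classic (simple_mod M)) => [sM|nM].
  by exists M, 1%:M; split=> //; [exact: hom_1 | rewrite /row_free mxrank1].
case: (classic (exists W : 'M[K]_(fdim M), [/\ is_submod W, W != 0 & ~~ row_full W])).
  move=> [W [hW W0 nf]]; have [S [g [hg fg eg]]] := sub_exists hW.
  have rS : fdim S = \rank W by rewrite -eg (eqP fg).
  have [||T [s [sT hs fs]]] := IH S.
  - rewrite -ltnS; apply: leq_trans le; rewrite rS ltn_neqAle nf.
    exact: rank_leq_col.
  - by rewrite rS lt0n mxrank_eq0.
  by exists T, (s *m g); split=> //; [exact: hom_comp | exact: row_free_mul].
move=> H; case: nM; apply: simple_mod_intro => // W hW W0.
by apply: contraT => nf; case: H; exists W.
Qed.

Lemma simple_quo_exists M : (0 < fdim M)%N ->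
  exists S (t : 'M[K]_(fdim M, fdim S)), [/\ simple_mod S, is_hom t & row_full t].
Proof.
move: {2}(fdim M) (leqnn (fdim M)) => n; elim: n M => [|n IH] M le d0.
  by move: d0; rewrite ltnNge le.
case: (classic (simple_mod M)) => [sM|nM].
  by exists M, 1%:M; split=> //; [exact: hom_1 | rewrite /row_full mxrank1].
case: (classic (exists W : 'M[K]_(fdim M), [/\ is_submod W, W != 0 & ~~ row_full W])).
  move=> [W [hW W0 nf]]; have [C [g [hg fg eg]]] := quo_exists hW.
  have rC : (\rank W + fdim C)%N = fdim M.
    by rewrite -eg mxrank_ker (eqP fg) subnK // -(eqP fg) rank_leq_row.
  have [||T [s [sT hs fs]]] := IH C.
  - rewrite -ltnS; apply: leq_trans le; rewrite -rC -add1n leq_add2r.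
    by rewrite lt0n mxrank_eq0.
  - rewrite lt0n; apply: contraNneq nf => e0.
    by apply/eqP; rewrite -[RHS]rC e0 addn0.
  by exists T, (g *m s); split=> //; [exact: hom_comp | exact: row_full_mul].
move=> H; case: nM; apply: simple_mod_intro => // W hW W0.
by apply: contraT => nf; case: H; exists W.
Qed.

Lemma fdim0_eq0 m M (f : 'M[K]_(m, fdim M)) : fdim M = 0%N -> f = 0.
Proof. by move=> e; apply/eqP; rewrite -mxrank_eq0 -leqn0; apply: leq_trans (rank_leq_col f) _; rewrite e. Qed.

(** The top quotient N is split off and the rest X is kept as a module of its own; inductions then
    run over modules instead of chains of subspaces in a fixed M. *)
Inductive filtered (P : fmod B -> Prop) : fmod B -> Prop :=
| filtered0 M : fdim M = 0%N -> filtered P M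
| filteredS X M N (f : 'M[K]_(fdim X, fdim M)) (p : 'M[K]_(fdim M, fdim N)) :
    P N -> filtered P X -> exact3 f p -> filtered P M.

Lemma filtered_inv (P : fmod B -> Prop) M : filtered P M -> fdim M = 0%N \/
  exists X N (f : 'M[K]_(fdim X, fdim M)) (p : 'M[K]_(fdim M, fdim N)),
    [/\ P N, filtered P X & exact3 f p].
Proof. by case=> {M} [M d0|X M N f p PN FX E]; [left | right; exists X, N, f, p]. Qed.

Lemma filt_by_filtered (P : fmod B -> Prop) M : filt_by P M -> filtered P M.
Proof.
move=> [k [c [c0 ck H]]].
(* Here m counts layers from the bottom of the chain, and S is a module representing [c (k - m)]. *)
suff G m : (m <= k)%N -> forall S (g : 'M[K]_(fdim S, fdim M)), is_hom g -> row_free g ->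
    (g :=: c (k - m)%N)%MS -> filtered P S.
  apply: (G k (leqnn k) M 1%:M); [exact: hom_1 | by rewrite /row_free mxrank1 |].
  by rewrite subnn c0.
elim: m => [_|m IH lt] S g hg fg eg.
  by apply: filtered0; rewrite -(eqP fg) eg subn0 ck mxrank0.
have [|N PN sq] := H (k - m.+1)%N; first by rewrite ltn_subrL (leq_trans _ lt).
have ej : (k - m.+1).+1 = (k - m)%N by rewrite -subSn.
rewrite ej in sq.
have [q [hq fq ek]] := sq_isoP sq hg fg eg.
have [X [f E]] := exact_of_epi hq fq.
have [hf ff _ _ ef] := E.
apply: (filteredS PN _ E); apply: (IH (ltnW lt) X (f *m g)).
- exact: hom_comp.
- exact: row_free_mul.
by apply: eqmx_trans ek; exact: eqmxMr.
Qed.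

Lemma filtered_filt_by (P : fmod B -> Prop) M : filtered P M -> filt_by P M.
Proof.
elim=> {M} [M d0|X M N f p PN _ [k [c [c0 ck H]]] E].
  exists 0%N, (fun _ => 1%:M); split=> //.
  exact: fdim0_eq0.
have [hf ff hp fp e] := E.
exists k.+1, (fun j => if j is i.+1 then <<c i *m f>>%MS else 1%:M); split=> //.
  by rewrite ck mul0mx genmx0.
case=> [|j] lt.
  exists N => //; apply: (sq_iso_top_intro hp fp).
  by rewrite c0 mul1mx; apply: eqmx_trans (eqmx_sym (genmxE f)); exact: eqmx_sym.
have [N' PN' sq] := H j lt; exists N' => //.
have hU : is_submod (c j) by case: sq.
have [S [g [hg fg eg]]] := sub_exists hU.
have [q [hq fq ek]] := sq_isoP sq hg fg eg.
apply: (@sq_iso_intro _ _ _ _ _ _ _ _ _ (g *m f) q) => //.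
- exact: hom_comp.
- exact: row_free_mul.
- by apply: eqmx_trans (eqmx_sym (genmxE _)); exact: eqmxMr.
by rewrite mulmxA; apply: eqmx_trans (eqmx_sym (genmxE _)); exact: eqmxMr.
Qed.

Lemma simple_filtered M : filtered (@simple_mod K B) M.
Proof.
move: {2}(fdim M) (leqnn (fdim M)) => n; elim: n M => [|n IH] M le.
  by apply: filtered0; apply/eqP; rewrite -leqn0.
case: (posnP (fdim M)) => [|d0]; first exact: filtered0.
have [S [t [sS ht ft]]] := simple_quo_exists d0.
have [X [f E]] := exact_of_epi ht ft.
apply: (filteredS sS _ E); apply: IH; rewrite -ltnS; apply: leq_trans le.
rewrite (exact_dim E) -addn1 leq_add2l; by case: (simple_modP sS).
Qed.

End Simples.

(** * Projective covers and injective hulls *)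

Section Regular.
Local Open Scope ring_scope.
Set Implicit Arguments.
Unset Strict Implicit.
Variables (K : fieldType) (B : falgType K).
Implicit Types (M N X Y S C : fmod B).

(** * The regular module and its dual *)

Notation dB := (dim B).

Definition lmul_mx (b : B) : 'M[K]_dB := lin1_mx (fun r : 'rV[K]_dB => v2r (b * r2v r)).
Definition rmul_mx (b : B) : 'M[K]_dB := lin1_mx (fun r : 'rV[K]_dB => v2r (r2v r * b)).

Lemma lmul_mxE b (r : 'rV_dB) : r *m lmul_mx b = v2r (b * r2v r).
Proof.
pose f := fun r : 'rV[K]_dB => v2r (b * r2v r).
have lf : linear f by move=> a u v; rewrite /f linearP mulrDr -scalerAr linearP.
pose fl := GRing.isLinear.Build _ _ _ _ f lf.
pose F : {linear 'rV[K]_dB -> 'rV[K]_dB} := HB.pack f fl.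
exact: (mul_rV_lin1 F).
Qed.

Lemma rmul_mxE b (r : 'rV_dB) : r *m rmul_mx b = v2r (r2v r * b).
Proof.
pose f := fun r : 'rV[K]_dB => v2r (r2v r * b).
have lf : linear f by move=> a u v; rewrite /f linearP mulrDl -scalerAl linearP.
pose fl := GRing.isLinear.Build _ _ _ _ f lf.
pose F : {linear 'rV[K]_dB -> 'rV[K]_dB} := HB.pack f fl.
exact: (mul_rV_lin1 F).
Qed.

Lemma eq_row_mx m n (A A' : 'M[K]_(m, n)) : (forall r : 'rV_m, r *m A = r *m A') -> A = A'.
Proof. by move=> H; apply/row_matrixP => i; rewrite !rowE. Qed.

Lemma eq_v2r n (A A' : 'M[K]_(dB, n)) :
  (forall x : B, v2r x *m A = v2r x *m A') -> A = A'.
Proof. by move=> H; apply: eq_row_mx => r; rewrite -[r]r2vK. Qed.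

Lemma eq_v2r_tr n (A A' : 'M[K]_(n, dB)) :
  (forall x : B, A *m (v2r x)^T = A' *m (v2r x)^T) -> A = A'.
Proof.
move=> H; apply: trmx_inj; apply: eq_v2r => x; apply: trmx_inj.
by rewrite !trmx_mul !trmxK.
Qed.

Lemma lmul_mx_linear a x y : lmul_mx (a *: x + y) = a *: lmul_mx x + lmul_mx y.
Proof.
apply: eq_row_mx => r.
by rewrite mulmxDr -scalemxAr !lmul_mxE mulrDl -scalerAl linearP.
Qed.

Lemma lmul_mx1 : lmul_mx 1 = 1%:M.
Proof. by apply: eq_row_mx => r; rewrite lmul_mxE mul1r r2vK mulmx1. Qed.

Lemma lmul_mxM x y : lmul_mx (x * y) = lmul_mx y *m lmul_mx x.
Proof. by apply: eq_row_mx => r; rewrite mulmxA !lmul_mxE v2rK mulrA. Qed.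

Definition regm : fmod B := FMod dB lmul_mx lmul_mx_linear lmul_mx1 lmul_mxM.

Lemma rmul_mx_linear a x y : (rmul_mx (a *: x + y))^T = a *: (rmul_mx x)^T + (rmul_mx y)^T.
Proof.
rewrite -linearP; congr (_^T); apply: eq_row_mx => r.
by rewrite mulmxDr -scalemxAr !rmul_mxE mulrDr -scalerAr linearP.
Qed.

Lemma rmul_mx1 : (rmul_mx 1)^T = 1%:M.
Proof. by rewrite -trmx1; congr (_^T); apply: eq_row_mx => r; rewrite rmul_mxE mulr1 r2vK mulmx1. Qed.

Lemma rmul_mxM x y : (rmul_mx (x * y))^T = (rmul_mx y)^T *m (rmul_mx x)^T.
Proof.
by rewrite -trmx_mul; congr (_^T); apply: eq_row_mx => r; rewrite mulmxA !rmul_mxE v2rK mulrA.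
Qed.

(** The K-dual of the right regular module: a row r is the linear form x -> r x^T, and (b r)(x) = r
    (x b). *)
Definition dualm : fmod B := FMod dB (fun b => (rmul_mx b)^T) rmul_mx_linear rmul_mx1 rmul_mxM.

Lemma ev_exists M (m : 'rV[K]_(fdim M)) :
  exists f : 'M[K]_(dB, fdim M), @is_hom K B regm M f /\ forall x : B, v2r x *m f = m *m fact M x.
Proof.
pose f := fun r : 'rV[K]_dB => m *m fact M (r2v r).
have lf : linear f.
  by move=> a u v; rewrite /f linearP fact_linear mulmxDr -scalemxAr.
pose fl := GRing.isLinear.Build _ _ _ _ f lf.
pose F : {linear 'rV[K]_dB -> 'rV[K]_(fdim M)} := HB.pack f fl.
have e r : r *m lin1_mx F = m *m fact M (r2v r) := mul_rV_lin1 F r.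
exists (lin1_mx F); split; last by move=> x; rewrite e v2rK.
move=> b; apply: eq_row_mx => r.
by rewrite [LHS](mulmxA r (lmul_mx b)) lmul_mxE e v2rK factM !mulmxA e.
Qed.

Lemma regm_projective : projective regm.
Proof.
move=> X Y g h hg fg hh.
have [m em] : exists m, v2r (1 : B) *m (h : 'M[K]_(dB, fdim Y)) = m *m g by apply/submxP; exact: submx_full.
have [f [hf ef]] := ev_exists m; exists f; split=> //.
apply: eq_v2r => x; rewrite [LHS](mulmxA (v2r x) f g) ef -mulmxA hg mulmxA -em.
have hx : lmul_mx x *m h = h *m fact Y x := hh x.
by rewrite -mulmxA -hx mulmxA lmul_mxE v2rK mulr1.
Qed.

Lemma dual_hom_exists M (c : 'cV[K]_(fdim M)) :
  exists f : 'M[K]_(fdim M, dB),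
    @is_hom K B M dualm f /\ forall x : B, f *m (v2r x)^T = fact M x *m c.
Proof.
pose f := fun r : 'rV[K]_dB => (fact M (r2v r) *m c)^T.
have lf : linear f.
  by move=> a u v; rewrite /f linearP fact_linear mulmxDl -scalemxAl linearP.
pose fl := GRing.isLinear.Build _ _ _ _ f lf.
pose F : {linear 'rV[K]_dB -> 'rV[K]_(fdim M)} := HB.pack f fl.
have e r : r *m lin1_mx F = (fact M (r2v r) *m c)^T := mul_rV_lin1 F r.
have e' r : (lin1_mx F)^T *m r^T = fact M (r2v r) *m c by rewrite -trmx_mul e trmxK.
exists (lin1_mx F)^T; split; last by move=> x; rewrite e' v2rK.
move=> b; apply: trmx_inj; apply: eq_row_mx => r; apply: trmx_inj.
rewrite !trmx_mul !trmxK -mulmxA e' -(mulmxA (lin1_mx F)^T) -trmx_mul rmul_mxE e' v2rK.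
by rewrite factM mulmxA.
Qed.

Lemma dual_homE M (h : 'M[K]_(fdim M, dB)) (x : B) :
  @is_hom K B M dualm h -> h *m (v2r x)^T = fact M x *m ((h : 'M[K]_(_, dB)) *m (v2r (1 : B))^T).
Proof.
move=> hh; rewrite mulmxA hh /= -mulmxA -trmx_mul rmul_mxE v2rK mul1r //.
Qed.

(** A map M -> [dualm] amounts to a linear form on M, its value at 1, and linear forms extend along
    injections. *)
Lemma dualm_injective : Defs.injective dualm.
Proof.
move=> X Y g h hg fg hh.
have [c' ec] : exists c', g *m c' = (h : 'M[K]_(_, dB)) *m (v2r (1 : B))^T.
  by exists (pinvmx g *m ((h : 'M[K]_(_, dB)) *m (v2r (1 : B))^T)); rewrite mulmxA mulmxVp ?mul1mx.
have [f [hf ef]] := dual_hom_exists c'; exists f; split=> //.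
apply: eq_v2r_tr => x.
rewrite -[LHS](mulmxA g f (v2r x)^T) ef mulmxA -hg -mulmxA ec.
by rewrite -(dual_homE _ hh).
Qed.

Lemma proj_onto_exists S : simple_mod S ->
  exists P (t : 'M[K]_(fdim P, fdim S)), [/\ projective P, is_hom t & row_full t].
Proof.
move=> sS; have [d0 _] := simple_modP sS.
(* Any nonzero vector of S would serve; [const_mx 1] is one because S has positive dimension. *)
have [f [hf ef]] := ev_exists (const_mx 1 : 'rV[K]_(fdim S)).
exists regm, f; split=> //; first exact: regm_projective.
apply: simple_epi => //; apply/eqP => f0.
have := ef 1; rewrite f0 mulmx0 fact1 mulmx1 => /matrixP/(_ 0 (Ordinal d0)).
by rewrite !mxE => /eqP; rewrite eq_sym oner_eq0.
Qed.

Lemma inj_under_exists S : simple_mod S ->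
  exists Q (s : 'M[K]_(fdim S, fdim Q)), [/\ Defs.injective Q, is_hom s & row_free s].
Proof.
move=> sS; have [d0 _] := simple_modP sS.
have [f [hf ef]] := dual_hom_exists (const_mx 1 : 'cV[K]_(fdim S)).
exists dualm, f; split=> //; first exact: dualm_injective.
apply: simple_mono => //; apply/eqP => f0.
have := ef 1; rewrite f0 mul0mx fact1 mul1mx => /matrixP/(_ (Ordinal d0) 0).
by rewrite !mxE => /eqP; rewrite eq_sym oner_eq0.
Qed.

(* The last clause says that the kernel of t is superfluous. *)
Definition pcover S P (t : 'M[K]_(fdim P, fdim S)) :=
  [/\ projective P, is_hom t, row_full t &
      forall X (f : 'M[K]_(fdim X, fdim P)), is_hom f -> f *m t != 0 -> row_full f].

(* The last clause says that the image of s is essential. *)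
Definition ihull S Q (s : 'M[K]_(fdim S, fdim Q)) :=
  [/\ Defs.injective Q, is_hom s, row_free s &
      forall X (f : 'M[K]_(fdim Q, fdim X)), is_hom f -> s *m f != 0 -> row_free f].

Lemma ex_min_rank M (P : 'M[K]_(fdim M) -> Prop) :
  (exists e, P e) -> exists e, P e /\ forall e', P e' -> (\rank e <= \rank e')%N.
Proof.
move=> [e0]; move: {2}(\rank e0) (leqnn (\rank e0)) => n; elim: n e0 => [|n IH] e0 le Pe0.
  by exists e0; split=> // e' _; apply: leq_trans le _.
case: (classic (exists e', P e' /\ (\rank e' < \rank e0)%N)) => [[e' [Pe' lt]]|H].
  by apply: (IH e') => //; rewrite -ltnS; exact: leq_trans lt le.
exists e0; split=> // e' Pe'; rewrite leqNgt; apply/negP => lt.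
by apply: H; exists e'.
Qed.

(* An endomorphism of least rank among those compatible with the map to (or
   from) S splits, and its image is the cover (or the hull). *)
Lemma min_rank_split M I (q : 'M[K]_(fdim M, fdim I)) (m : 'M[K]_(fdim I, fdim M)) :
  is_hom q -> is_hom m -> row_free m -> row_full q ->
  (\rank (q *m m) <= \rank (q *m m *m (q *m m)))%N ->
  exists a : 'M[K]_(fdim I), [/\ is_hom a, m *m q *m a = 1%:M & a *m (m *m q) = 1%:M].
Proof.
move=> hq hm fm fq.
rewrite -mulmxA !(eqmxMfull _ fq) mulmxA mxrankMfree // (eqP fm) => le.
have ff : row_free (m *m q) by rewrite /row_free eqn_leq rank_leq_row.
have fu : row_full (m *m q) by rewrite /row_full eqn_leq rank_leq_col.
have [a [ha e1 e2 _ _]] := iso_inv (hom_comp hm hq) ff fu.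
by exists a.
Qed.

Lemma pcover_exists S : simple_mod S -> exists P (t : 'M[K]_(fdim P, fdim S)), pcover t.
Proof.
move=> sS; have [d0 _] := simple_modP sS.
have [F [t0 [pF ht0 ft0]]] := proj_onto_exists sS.
have [|e [[he ee] emin]] := @ex_min_rank F (fun e => is_hom e /\ e *m t0 = t0).
  by exists 1%:M; split; [exact: hom_1 | rewrite mul1mx].
have [P [q [m [hq fq hm fm eqm]]]] := image_factor he.
have [|a [ha a1 a2]] := min_rank_split hq hm fm fq.
  by rewrite eqm; apply: emin; split; [exact: hom_comp | rewrite -mulmxA !ee].
have qt : q *m (m *m t0) = t0 by rewrite mulmxA eqm.
have hmt := hom_comp hm ht0.
have ft : row_full (m *m t0) by apply: (@row_full_mulr _ _ _ _ q); rewrite qt.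
exists P, (m *m t0); split=> //.
  move=> X Y g h hg fg hh.
  have [h' [hh' eh]] := pF X Y g (q *m h) hg fg (hom_comp hq hh).
  (* P is a direct summand of F: [a *m m] is a section of q. So the lift found on F restricts to
     P. *)
  exists (a *m m *m h'); split; first by do 2?apply: hom_comp.
  by rewrite -mulmxA eh -(mulmxA a) (mulmxA m) (mulmxA a) a2 mul1mx.
move=> X f hf n0.
have fft := simple_epi sS (hom_comp hf hmt) n0.
(* The composite [u *m f *m m] is again an endomorphism of F over t0, so the minimal rank of e
   bounds its rank from below and forces f to be onto. *)
have [u [hu eu]] := pF X S _ t0 (hom_comp hf hmt) fft ht0.
have le : (\rank e <= \rank (u *m f *m m))%N.
  apply: emin; split; first by do 2?apply: hom_comp.
  by rewrite -mulmxA -(mulmxA u).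
rewrite mxrankMfree // -eqm mxrankMfree // (eqP fq) in le.
by rewrite /row_full eqn_leq rank_leq_col (leq_trans le) // mxrankM_maxr.
Qed.

Lemma ihull_exists S : simple_mod S -> exists Q (s : 'M[K]_(fdim S, fdim Q)), ihull s.
Proof.
move=> sS; have [d0 _] := simple_modP sS.
have [F [s0 [pF hs0 fs0]]] := inj_under_exists sS.
have [|e [[he ee] emin]] := @ex_min_rank F (fun e => is_hom e /\ s0 *m e = s0).
  by exists 1%:M; split; [exact: hom_1 | rewrite mulmx1].
have [Q [q [m [hq fq hm fm eqm]]]] := image_factor he.
have [|a [ha a1 a2]] := min_rank_split hq hm fm fq.
  by rewrite eqm; apply: emin; split; [exact: hom_comp | rewrite mulmxA !ee].
have sm : s0 *m q *m m = s0 by rewrite -mulmxA eqm.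
have hsq := hom_comp hs0 hq.
have fs : row_free (s0 *m q) by apply: (@row_free_mull _ _ _ _ _ m); rewrite sm.
exists Q, (s0 *m q); split=> //.
  move=> X Y g h hg fg hh.
  have [h' [hh' eh]] := pF X Y g (h *m m) hg fg (hom_comp hh hm).
  exists (h' *m (q *m a)); split; first by do 2?apply: hom_comp.
  by rewrite mulmxA eh -mulmxA (mulmxA m) a1 mulmx1.
move=> X f hf n0.
have fsf := simple_mono sS (hom_comp hsq hf) n0.
have [u [hu eu]] := pF S X _ s0 (hom_comp hsq hf) fsf hs0.
have le : (\rank e <= \rank (q *m f *m u))%N.
  apply: emin; split; first by do 2?apply: hom_comp.
  by rewrite !mulmxA.
rewrite -eqm mxrankMfree // (eqP fq) -mulmxA (eqmxMfull _ fq) in le.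
by rewrite /row_free eqn_leq rank_leq_row (leq_trans le) // mxrankM_maxl.
Qed.

(** * Direct sums and enough projectives *)

Definition dsum_act M N (b : B) : 'M[K]_(fdim M + fdim N) :=
  block_mx (fact M b) 0 0 (fact N b).

Lemma dsum_linear M N a x y :
  dsum_act M N (a *: x + y) = a *: dsum_act M N x + dsum_act M N y.
Proof. by rewrite /dsum_act scale_block_mx add_block_mx !fact_linear !scaler0 !addr0. Qed.

Lemma dsum1 M N : dsum_act M N 1 = 1%:M.
Proof. by rewrite /dsum_act !fact1 -scalar_mx_block. Qed.

Lemma dsumM M N x y : dsum_act M N (x * y) = dsum_act M N y *m dsum_act M N x.
Proof. by rewrite /dsum_act mulmx_block !factM !(mulmx0, mul0mx, addr0, add0r). Qed.

Definition dsum M N : fmod B :=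
  FMod (fdim M + fdim N) (dsum_act M N) (@dsum_linear M N) (dsum1 M N) (@dsumM M N).

Lemma dsum_hom M N X (f : 'M[K]_(fdim M, fdim X)) (g : 'M[K]_(fdim N, fdim X)) :
  is_hom f -> is_hom g -> @is_hom K B (dsum M N) X (col_mx f g).
Proof.
move=> hf hg b.
rewrite [LHS](mul_block_col (fact M b) 0 0 (fact N b) f g) [RHS](mul_col_mx f g (fact X b)).
by rewrite !mul0mx addr0 add0r hf hg.
Qed.

Lemma dsum_projective P P' : projective P -> projective P' -> projective (dsum P P').
Proof.
move=> pP pP' X Y g h hg fg hh.
have eh : h = col_mx (usubmx h) (dsubmx h) by rewrite vsubmxK.
have E b : fact (dsum P P') b *m h =
    col_mx (fact P b *m usubmx h) (fact P' b *m dsubmx h).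
  rewrite {1}eh [LHS](mul_block_col (fact P b) 0 0 (fact P' b)).
  by rewrite !mul0mx addr0 add0r.
have h1 : @is_hom K B P Y (usubmx h).
  by move=> b; have /(congr1 usubmx) := E b; rewrite hh col_mxKu => <-; rewrite mul_usub_mx.
have h2 : @is_hom K B P' Y (dsubmx h).
  by move=> b; have /(congr1 dsubmx) := E b; rewrite hh col_mxKd => <-; rewrite mul_dsub_mx.
have [f1 [hf1 e1]] := pP X Y g _ hg fg h1.
have [f2 [hf2 e2]] := pP' X Y g _ hg fg h2.
exists (col_mx f1 f2); split; first exact: dsum_hom.
by rewrite mul_col_mx e1 e2 -eh.
Qed.

(** As long as some vector v of M is missed, one more copy of B sending 1 to v is added, and the
    rank of the map grows. *)
Lemma enough_projectives M :
  exists P (q : 'M[K]_(fdim P, fdim M)), [/\ projective P, is_hom q & row_full q].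
Proof.
suff G k : (k <= fdim M)%N -> exists P (q : 'M[K]_(fdim P, fdim M)),
    [/\ projective P, is_hom q & (k <= \rank q)%N].
  have [P [q [pP hq le]]] := G _ (leqnn _); exists P, q; split=> //.
  by rewrite /row_full eqn_leq rank_leq_col.
elim: k => [_|k IH lt].
  by exists regm, 0; split=> //; [exact: regm_projective | exact: hom_0].
have [P [q [pP hq le]]] := IH (ltnW lt).
case: (boolP (row_full q)) => [/eqP e|nf].
  by exists P, q; rewrite e.
have [v nv] : exists v : 'rV_(fdim M), ~~ (v <= q)%MS.
  have /row_subPn [i ni] : ~~ (1%:M <= q)%MS by rewrite sub1mx.
  by exists (row i 1%:M).
have [f [hf ef]] := ev_exists v.
exists (dsum P regm), (col_mx q f); split.
- by apply: dsum_projective => //; exact: regm_projective.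
- exact: dsum_hom.
apply: leq_ltn_trans le _; rewrite -addsmxE; apply: (@rank_ltmx K).
rewrite ltmxE addsmxSl /=; apply: contra nv => le; apply: submx_trans le.
apply: submx_trans (addsmxSr _ _).
have := ef 1; rewrite fact1 mulmx1 => <-; exact: submxMl.
Qed.

End Regular.

(** * Standard and costandard modules *)

Section Standards.
Local Open Scope ring_scope.
Set Implicit Arguments.
Unset Strict Implicit.
Variables (K : fieldType) (B : falgType K).
Implicit Types (M N X Y S C P Q : fmod B).
Variables (L : lab -> fmod B) (Phi : pred lab) (le : rel lab).
Hypothesis hle : poset_on Phi le.
Hypothesis hL : simples_labelled L Phi.

Notation below := (below Phi le).
Notation standard := (standard L Phi le).
Notation costandard := (costandard L Phi le).

Lemma pullback S N I (q : 'M[K]_(fdim S, fdim N)) (m : 'M[K]_(fdim I, fdim N)) :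
  is_hom q -> row_full q -> is_hom m -> row_free m ->
  exists X (a : 'M[K]_(fdim X, fdim S)) (r : 'M[K]_(fdim X, fdim I)),
    [/\ is_hom a /\ row_free a, is_hom r /\ row_full r, a *m q = r *m m & (a :=: kermx (q *m cokermx m))%MS].
Proof.
move=> hq fq hm fm.
have [X [a [ha fa ea]]] := sub_exists (preim_submod hq (hom_submod hm)).
have aqm : (a *m q <= m)%MS by rewrite -sub_preim ea.
have [r hr er] := factor_mono hm fm (hom_comp ha hq) aqm.
exists X, a, r; split=> //; split=> //.
have [u eu] : exists u, m = u *m q by apply/submxP; exact: submx_full.
have /submxP [v ev] : (u <= a)%MS by rewrite ea sub_preim -eu.
suff -> : row_full r = (1%:M <= r)%MS by rewrite -(submxMfree _ _ fm) mul1mx er eu ev -mulmxA submxMl.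
by rewrite sub1mx.
Qed.

Lemma simpleL x : Phi x -> simple_mod (L x).
Proof. by case: hL => + _ _; apply. Qed.

Lemma fdimL x : Phi x -> (0 < fdim (L x))%N.
Proof. by move=> /simpleL /simple_modP []. Qed.

Lemma simple_label S : simple_mod S ->
  exists2 x, Phi x & exists f : 'M[K]_(fdim S, fdim (L x)), [/\ is_hom f, row_free f & row_full f].
Proof. by case: hL => _ _ + sS => /(_ S sS) [x px /isoP H]; exists x. Qed.

Lemma homL x y (f : 'M[K]_(fdim (L x), fdim (L y))) :
  Phi x -> Phi y -> is_hom f -> f != 0 -> x = y.
Proof.
move=> px py hf f0; case: hL => _ + _; apply=> //.
by apply: (iso_intro hf); [exact: simple_mono (simpleL px) hf f0 | exact: simple_epi (simpleL py) hf f0].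
Qed.

Lemma mul_neq0_full m n p (f : 'M[K]_(m, n)) (g : 'M[K]_(n, p)) : row_full f -> g != 0 -> f *m g != 0.
Proof. by move=> ff; apply: contraNneq => e; apply/eqP; apply: (row_full_inj ff); rewrite e mulmx0. Qed.

Lemma mul_neq0_free m n p (f : 'M[K]_(m, n)) (g : 'M[K]_(n, p)) : row_free g -> f != 0 -> f *m g != 0.
Proof. by move=> fg; apply: contraNneq => e; apply/eqP; apply: (row_free_inj fg); rewrite /= e mul0mx. Qed.

(** With t = u f t, the summand 1 - u f is killed by t and u f factors through f, so both lie in
    A. *)
Lemma submx_of_mul m n p q (f : 'M[K]_(m, n)) (A : 'M[K]_(q, n)) (t : 'M[K]_(n, p)) :
  (t <= f *m t)%MS -> (kermx t <= A)%MS -> (f <= A)%MS -> row_full A.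
Proof.
move=> /submxP [u eu] kA fA; rewrite -sub1mx.
have -> : 1%:M = (1%:M - u *m f) + u *m f by rewrite subrK.
apply: addmx_sub; last by rewrite mulmx_sub.
by apply: submx_trans kA; rewrite sub_kermx mulmxBl mul1mx -mulmxA -eu subrr.
Qed.

(** * Covers, hulls and simple tops and socles *)

Lemma eqmx_row_full m p n (A : 'M[K]_(m, n)) (A' : 'M[K]_(p, n)) :
  (A :=: A')%MS -> row_full A = row_full A'.
Proof. by move=> e; rewrite /row_full e. Qed.

Lemma projcoverP x P : Phi x -> projcover L x P ->
  exists t : 'M[K]_(fdim P, fdim (L x)), pcover t.
Proof.
move=> px [pP [V [sq H]]]; have [t [ht ft et]] := sq_iso_top sq.
exists t; split=> // X f hf n0.
have hf' : is_submod <<f>>%MS.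
  by apply: (submod_eqmx _ (hom_submod hf)); apply: eqmx_sym; exact: genmxE.
have := H _ hf'; rewrite !submx1 !sub1mx /= => H'.
rewrite -(eqmx_row_full (genmxE f)); apply: H'.
apply: (submx_of_mul (t := t) (f := f)).
- exact: submx_full (simple_epi (simpleL px) (hom_comp hf ht) n0).
- by rewrite et addsmxSr.
by rewrite (submx_trans _ (addsmxSl _ _)) // genmxE.
Qed.

Lemma projcover_intro x P (t : 'M[K]_(fdim P, fdim (L x))) :
  Phi x -> pcover t -> projcover L x P.
Proof.
move=> px [pP ht ft H]; split=> //; exists (kermx t); split.
  exact: (sq_iso_top_intro ht ft).
move=> U hU; rewrite !submx1 !sub1mx /= => fU.
have [S [g [hg fg eg]]] := sub_exists hU.
rewrite -(eqmx_row_full eg); apply: H => //; apply/eqP => e0.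
have /eqP : t = 0.
  have t1 : (1%:M <= kermx t)%MS.
    apply: submx_trans (_ : (1%:M <= U + kermx t)%MS) _; first by rewrite sub1mx.
    by rewrite addsmx_sub submx_refl andbT -eg sub_kermx e0.
  by apply/eqP; rewrite -[t]mul1mx -sub_kermx.
by apply/negP; apply: row_full_neq0 => //; exact: fdimL.
Qed.

Lemma injhullP x Q : Phi x -> injhull L x Q ->
  exists s : 'M[K]_(fdim (L x), fdim Q), ihull s.
Proof.
move=> px [iQ [W [sq H]]]; have [s [hs fs es]] := sq_iso_bot sq.
exists s; split=> // X f hf n0; rewrite -kermx_eq0 -mxrank_eq0.
apply: contraT => r0.
have fsf := simple_mono (simpleL px) (hom_comp hs hf) n0.
have := H _ (ker_submod hf) r0; rewrite mxrank_eq0.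
have /submxP [w ew] : (kermx f :&: W <= s)%MS by rewrite es capmxSr.
suff /eqP -> : (kermx f :&: W)%MS == 0 by rewrite eqxx.
have : (w *m s <= kermx f)%MS by rewrite -ew capmxSl.
by rewrite sub_kermx -mulmxA mulmx_free_eq0 // => /eqP w0; rewrite ew w0 mul0mx.
Qed.

Lemma injhull_intro x Q (s : 'M[K]_(fdim (L x), fdim Q)) :
  Phi x -> ihull s -> injhull L x Q.
Proof.
move=> px [iQ hs fs H]; split=> //; exists <<s>>%MS; split.
  exact: (sq_iso_bot_intro _ hs fs (eqmx_sym (genmxE s))).
move=> U hU; apply: contraNneq => r0.
have [C [p [hp fp ep]]] := quo_exists hU.
rewrite -ep mxrank_eq0 kermx_eq0; apply: H => //.
apply/negP => sp0.
have sU : (s <= U)%MS by rewrite -ep sub_kermx.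
have : (\rank s <= \rank (U :&: <<s>>)%MS)%N by apply: mxrankS; rewrite sub_capmx sU genmxE /=.
by rewrite r0 (eqP fs) leqNgt fdimL.
Qed.

(** A nonzero quotient of P keeps its simple top: if t did not vanish on the kernel of p, that
    kernel would be all of P and N would be zero. Superfluity passes to N by pulling submodules back
    to P. *)
Lemma top_desc x N P (t : 'M[K]_(fdim P, fdim (L x))) (p : 'M[K]_(fdim P, fdim N)) :
  pcover t -> is_hom p -> row_full p -> (0 < fdim N)%N ->
  exists r : 'M[K]_(fdim N, fdim (L x)), [/\ is_hom r, row_full r, p *m r = t &
    forall X (f : 'M[K]_(fdim X, fdim N)), is_hom f -> f *m r != 0 -> row_full f].
Proof.
move=> [pP ht ft H] hp fp N0.
have [Z [k [hk fk ek]]] := ker_exists hp.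
have kp : k *m p = 0 by apply/eqP; rewrite -sub_kermx ek.
have [|r hr er] := factor_epi hp fp ht.
  apply: (@kermx_sub_mul0 _ _ _ _ _ _ k); first by rewrite ek.
  apply/eqP; apply: contraTT N0 => n0; rewrite -eqn0Ngt -(eqP fp) mxrank_eq0.
  by apply/eqP; apply: (row_full_inj (H _ _ hk n0)); rewrite mulmx0.
exists r; split=> //; first by apply: (@row_full_mulr _ _ _ _ p); rewrite er.
move=> X f hf n0.
have [I [q [m [hq fq hm fm eqm]]]] := image_factor hf.
have [Y [a [c [[ha fa] [hc fc] eac _]]]] := pullback hp fp hm fm.
have fua : row_full a.
  apply: H => //; rewrite -er mulmxA eac -mulmxA; apply: mul_neq0_full => //.
  by apply: contraNneq n0 => e0; rewrite -eqm -mulmxA e0 mulmx0.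
rewrite -eqm; apply: row_full_mul => //.
by apply: (@row_full_mulr _ _ _ _ c); rewrite -eac row_full_mul.
Qed.

(** The projection of Q modulo the image of g is not injective, so by essentiality it kills s. *)
Lemma hull_sub S X Q (s : 'M[K]_(fdim S, fdim Q)) (g : 'M[K]_(fdim X, fdim Q)) :
  simple_mod S -> ihull s -> is_hom g -> g != 0 -> (s <= g)%MS.
Proof.
move=> sS [_ hs fs H] hg g0; apply: contraNT g0 => ns.
have [C [p [hp fp ep]]] := quo_exists (hom_submod hg).
have : row_free p by apply: H => //; apply: contra ns; rewrite -ep sub_kermx.
by rewrite -kermx_eq0 -mxrank_eq0 ep mxrank_eq0.
Qed.

Lemma hull_desc S I Q (s : 'M[K]_(fdim S, fdim Q)) (m : 'M[K]_(fdim I, fdim Q)) :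
  simple_mod S -> ihull s -> is_hom m -> row_free m -> (0 < fdim I)%N ->
  exists s' : 'M[K]_(fdim S, fdim I), [/\ is_hom s', row_free s', s' *m m = s &
    forall X (f : 'M[K]_(fdim X, fdim I)), is_hom f -> f != 0 -> (s' <= f)%MS].
Proof.
move=> sS hsQ hm fm I0; have [_ hs fs _] := hsQ.
have [s' hs' es'] := factor_mono hm fm hs (hull_sub sS hsQ hm (row_free_neq0 I0 fm)).
exists s'; split=> //; first by apply: (@row_free_mull _ _ _ _ _ m); rewrite es'.
move=> X f hf f0; rewrite -(submxMfree _ _ fm) es'.
by apply: hull_sub => //; [exact: hom_comp | exact: mul_neq0_free].
Qed.

Lemma pcover_homL x y P (t : 'M[K]_(fdim P, fdim (L x))) (f : 'M[K]_(fdim P, fdim (L y))) :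
  Phi x -> Phi y -> pcover t -> is_hom f -> f != 0 -> x = y.
Proof.
move=> px py ct hf f0; have [_ _ ft _] := ct.
have [h [hh _ eh _]] := top_desc ct hf (simple_epi (simpleL py) hf f0) (fdimL py).
apply: esym; apply: (@homL _ _ h) => //; apply/eqP => h0.
by have := row_full_neq0 (fdimL px) ft; rewrite -eh h0 mulmx0 eqxx.
Qed.

(* All composition factors of M have labels in T. *)
Definition dom (T : pred lab) M := forall y P (t : 'M[K]_(fdim P, fdim (L y))),
  Phi y -> ~~ T y -> pcover t -> forall f : 'M[K]_(fdim P, fdim M), is_hom f -> f = 0.

Lemma dom_mono T S M (g : 'M[K]_(fdim S, fdim M)) : is_hom g -> row_free g -> dom T M -> dom T S.
Proof.
move=> hg fg dM y P t py ny ct f hf; apply: (row_free_inj fg); rewrite /= mul0mx.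
by apply: (dM _ _ _ py ny ct); exact: hom_comp.
Qed.

Lemma dom_epi T M C (p : 'M[K]_(fdim M, fdim C)) : is_hom p -> row_full p -> dom T M -> dom T C.
Proof.
move=> hp fp dM y P t py ny ct f hf; have [pP _ _ _] := ct.
have [f' [hf' <-]] := pP _ _ p f hp fp hf.
by rewrite (dM _ _ _ py ny ct f' hf') mul0mx.
Qed.

Lemma dom_ext T X M N (f : 'M[K]_(fdim X, fdim M)) (p : 'M[K]_(fdim M, fdim N)) :
  exact3 f p -> dom T X -> dom T N -> dom T M.
Proof.
move=> E dX dN y P t py ny ct g hg; have [_ _ hp _ _] := E.
have [h hh <-] := exact_lift E hg (dN _ _ _ py ny ct _ (hom_comp hg hp)).
by rewrite (dX _ _ _ py ny ct h hh) mul0mx.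
Qed.

Lemma dom_sub (T T' : pred lab) M : (forall y, Phi y -> T y -> T' y) -> dom T M -> dom T' M.
Proof. by move=> TT' dM y P t py ny; apply: dM => //; apply: contra ny; exact: TT'. Qed.

Lemma domL (T : pred lab) x : Phi x -> T x -> dom T (L x).
Proof.
move=> px Tx y P t py ny ct f hf; apply/eqP; apply: contraNT ny => f0.
by rewrite (pcover_homL py px ct hf f0).
Qed.

Lemma domL_inv (T : pred lab) x : Phi x -> dom T (L x) -> T x.
Proof.
move=> px d; apply: contraT => nx.
have [P [t ct]] := pcover_exists (simpleL px).
have [_ ht ft _] := ct.
by have := row_full_neq0 (fdimL px) ft; rewrite (d x P t px nx ct t ht) eqxx.
Qed.

(** Translates labels of simple sections into maps out of projective covers. The image of a nonzero
    map P_y -> N has top L_y, and its preimage in U yields a simple section labelled y. Conversely,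
    a section labelled y outside T lifts the top of P_y to a map into U that is nonzero modulo
    V'. *)
Lemma secfactorsP (T : pred lab) M m1 m2 (U : 'M[K]_(m1, fdim M)) (V : 'M[K]_(m2, fdim M)) N :
  (forall y, T y -> Phi y) -> sq_iso M U V N -> (secfactors L T U V <-> dom T N).
Proof.
move=> TP sq; have hU : is_submod U by case: sq.
have [S [g [hg fg eg]]] := sub_exists hU.
have [q [hq fq ek]] := sq_isoP sq hg fg eg.
split.
  move=> H y P t py ny ct f hf; apply/eqP; apply: contraNT ny => f0.
  have [I [c [m [hc fc hm fm ecm]]]] := image_factor hf.
  have I0 : (0 < fdim I)%N.
    by rewrite lt0n; apply: contraNneq f0 => d0; rewrite -ecm (fdim0_eq0 c d0) mul0mx.
  have [r [hr fr _ _]] := top_desc ct hc fc I0.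
  have [X [a [r' [[ha fa] [hr' fr'] ear ka]]]] := pullback hq fq hm fm.
  have hag := hom_comp ha hg.
  have sq' : sq_iso M <<a *m g>>%MS <<kermx (r' *m r) *m (a *m g)>>%MS (L y).
    apply: (sq_iso_intro hag (row_free_mul fa fg) _ (hom_comp hr' hr) (row_full_mul fr' fr)).
      by apply: eqmx_sym; exact: genmxE.
    by apply: eqmx_sym; exact: genmxE.
  have [||z Tz sqz] := H _ _ _ _ (simple_sec_intro (simpleL py) sq').
  - rewrite genmxE -ek mulmxA; apply: submxMr.
    have /submxP [z ez] : (kermx q <= a)%MS by rewrite ka sub_preim mulmx_ker sub0mx.
    rewrite ez; apply: submxMr.
    rewrite sub_kermx mulmxA; apply/eqP.
    have -> : z *m r' = 0; last by rewrite mul0mx.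
    by apply: (row_free_inj fm); rewrite /= mul0mx -mulmxA -ear mulmxA -ez mulmx_ker.
  - by rewrite genmxE -eg submxMl.
  have [h [hh fh kh]] := sq_isoP sqz hag (row_free_mul fa fg) (eqmx_sym (genmxE _)).
  have kle : (kermx (r' *m r) <= kermx h)%MS.
    by rewrite -(submxMfree _ _ (row_free_mul fa fg)) kh genmxE.
  have [|w hw ew] := factor_epi (hom_comp hr' hr) (row_full_mul fr' fr) hh.
    by apply/eqP; rewrite -sub_kermx.
  have pz := TP _ Tz.
  rewrite (@homL _ _ w py pz hw) //; apply/eqP => w0.
  by have := row_full_neq0 (fdimL pz) fh; rewrite -ew w0 mulmx0 eqxx.
move=> dN U' V' VV' UU' ss.
have [C [sC sqC]] := simple_sec_quo ss.
have [y py [i [hi fi fui]]] := simple_label sC.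
have hU' : is_submod U' by case: ss.
have [S' [g' [hg' fg' eg']]] := sub_exists hU'.
have [c [hc fc ec]] := sq_isoP sqC hg' fg' eg'.
exists y; last first.
  apply: (sq_iso_intro hg' fg' eg' (hom_comp hc hi) (row_full_mul fc fui)).
  apply: eqmx_trans ec; apply: eqmxMr; apply/eqmxP.
  by rewrite !sub_kermx mulmxA mulmx_ker mul0mx eqxx /= -(mulmx_free_eq0 _ fi) -mulmxA mulmx_ker eqxx.
apply: contraT => ny.
have [P [t ct]] := pcover_exists (simpleL py).
have [pP ht ft _] := ct.
have [h [hh eh]] := pP _ _ _ t (hom_comp hc hi) (row_full_mul fc fui) ht.
have [|h2 hh2 eh2] := factor_mono hg fg (hom_comp hh hg').
  by rewrite eg; apply: submx_trans UU'; rewrite -eg' submxMl.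
have h2q := dN _ _ _ py ny ct _ (hom_comp hh2 hq).
have : (h *m g' <= V')%MS.
  apply: submx_trans VV'; rewrite -eh2 -ek; apply: submxMr.
  by rewrite sub_kermx h2q.
rewrite -ec submxMfree // sub_kermx => /eqP hc0.
by have := row_full_neq0 (fdimL py) ft; rewrite -eh mulmxA hc0 mul0mx eqxx.
Qed.

(** * Universal properties of standard and costandard modules *)

Lemma below_Phi x y : below x y -> Phi y.
Proof. by case/andP. Qed.

Lemma below_refl x : Phi x -> below x x.
Proof. by move=> px; rewrite /Defs.below px; case: hle => + _ _; apply. Qed.

Lemma standardP x N : Phi x -> standard x N ->
  exists P (t : 'M[K]_(fdim P, fdim (L x))) (p : 'M[K]_(fdim P, fdim N)),
    [/\ pcover t, is_hom p, row_full p, dom (below x) N &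
        forall M (f : 'M[K]_(fdim P, fdim M)), dom (below x) M -> is_hom f -> kermx p *m f = 0].
Proof.
move=> px [P [cP [V [sq sf H]]]]; have [t ct] := projcoverP px cP.
have [p [hp fp ep]] := sq_iso_top sq.
exists P, t, p; split=> //.
  by apply/(secfactorsP (@below_Phi x) sq).
move=> M f dM hf; have [I [q [m [hq fq hm fm eqm]]]] := image_factor hf.
have sqI : sq_iso P (1%:M : 'M_(fdim P)) (kermx q) I.
  exact: (sq_iso_top_intro hq fq (eqmx_refl _)).
have VI := H _ (ker_submod hq) (proj2 (secfactorsP (@below_Phi x) sqI) (dom_mono hm fm dM)).
by rewrite -eqm mulmxA; have : (kermx p <= kermx q)%MS; [rewrite ep | rewrite sub_kermx => /eqP ->; rewrite mul0mx].
Qed.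

(** P/(V :&: V') embeds into the sum of P/V and P/V': a map into it vanishes as soon as both
    components do. *)
Lemma dom_cap T P m1 m2 (V : 'M[K]_(m1, fdim P)) (V' : 'M[K]_(m2, fdim P))
  C1 C2 C (p1 : 'M[K]_(fdim P, fdim C1)) (p2 : 'M[K]_(fdim P, fdim C2)) (p : 'M[K]_(fdim P, fdim C)) :
  is_hom p1 -> is_hom p2 -> is_hom p -> row_full p ->
  (kermx p1 :=: V)%MS -> (kermx p2 :=: V')%MS -> (kermx p :=: V :&: V')%MS ->
  dom T C1 -> dom T C2 -> dom T C.
Proof.
move=> h1 h2 hp fp e1 e2 e d1 d2 y R t py ny ct f hf.
have [a1 ha1 ea1] : exists2 a, is_hom a & p *m a = p1.
  by apply: factor_epi => //; apply/eqP; rewrite -sub_kermx e e1 capmxSl.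
have [a2 ha2 ea2] : exists2 a, is_hom a & p *m a = p2.
  by apply: factor_epi => //; apply/eqP; rewrite -sub_kermx e e2 capmxSr.
have [h eh] : exists h, f = h *m p by apply/submxP; exact: submx_full.
apply/eqP; rewrite eh -sub_kermx e sub_capmx -e1 -e2 !sub_kermx -ea1 -ea2 !mulmxA -eh.
by rewrite (d1 _ _ _ py ny ct _ (hom_comp hf ha1)) (d2 _ _ _ py ny ct _ (hom_comp hf ha2)) !eqxx.
Qed.

(** Admissible kernels are closed under intersection by [dom_cap], so one of least rank is contained
    in all the others. *)
Lemma standard_exists x : Phi x -> exists N, standard x N.
Proof.
move=> px; have [P [t ct]] := pcover_exists (simpleL px).
pose good (V : 'M[K]_(fdim P)) :=
  is_submod V /\ secfactors L (below x) (1%:M : 'M[K]_(fdim P)) V.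
have goodP V : good V -> exists C (p : 'M[K]_(fdim P, fdim C)),
    [/\ is_hom p, row_full p, (kermx p :=: V)%MS & dom (below x) C].
  move=> [hV sV]; have [C [p [hp fp ep]]] := quo_exists hV.
  exists C, p; split=> //.
  by apply/(secfactorsP (@below_Phi x) (sq_iso_top_intro hp fp ep)).
have [|V [gV Vmin]] := @ex_min_rank K B P good.
  exists 1%:M; split; first exact: submod1.
  by move=> U' V' le1 _ [_ _ + _]; rewrite /ltmx => /andP [_ /negP]; case; exact: submx_trans (submx1 _) le1.
have [C [p [hp fp ep dC]]] := goodP _ gV.
exists C, P; split; first exact: projcover_intro ct.
exists V; split; [exact: sq_iso_top_intro fp ep | by case: gV |].
move=> V' hV' sV'.
have [C' [p' [hp' fp' ep' dC']]] := goodP _ (conj hV' sV').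
have hc : is_submod (V :&: V')%MS by apply: submod_cap => //; case: gV.
have [D [r [hr fr er]]] := quo_exists hc.
have dD := dom_cap hp hp' hr fr ep ep' er dC dC'.
have /Vmin leV : good (V :&: V')%MS.
  by split=> //; apply/(secfactorsP (@below_Phi x) (sq_iso_top_intro hr fr er)).
have : (V :&: V' == V)%MS by rewrite -(geq_leqif (mxrank_leqif_eq (capmxSl V V'))).
by move=> /andP [_ /submx_trans]; apply; exact: capmxSr.
Qed.

Lemma standard_top x N : Phi x -> standard x N ->
  exists t : 'M[K]_(fdim N, fdim (L x)), [/\ is_hom t, row_full t &
    forall X (f : 'M[K]_(fdim X, fdim N)), is_hom f -> f *m t != 0 -> row_full f].
Proof.
move=> px /(standardP px) [P [t [p [ct hp fp dN U]]]]; have [_ ht ft _] := ct.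
have [t' ht' et] := factor_epi hp fp ht (U _ _ (domL px (below_refl px)) ht).
have N0 : (0 < fdim N)%N.
  rewrite lt0n; apply: contraTneq (row_full_neq0 (fdimL px) ft) => d0.
  by rewrite -et (fdim0_eq0 p d0) mul0mx eqxx.
by have [r [hr fr _ H]] := top_desc ct hp fp N0; exists r.
Qed.

Lemma standard_fdim_gt0 x N : Phi x -> standard x N -> (0 < fdim N)%N.
Proof.
move=> px sN; have [t [_ ft _]] := standard_top px sN.
rewrite lt0n; apply: contraTneq (row_full_neq0 (fdimL px) ft) => d0.
by rewrite -mxrank_eq0 -leqn0 -d0 rank_leq_row.
Qed.

Lemma standard_dom x N : Phi x -> standard x N -> dom (below x) N.
Proof. by move=> px /(standardP px) [P [t [p []]]]. Qed.

(** A lift exists on the projective cover of L_x, and it descends to N because its target only has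
    factors below x. *)
Lemma standard_lift x N M C (e : 'M[K]_(fdim M, fdim C)) (h : 'M[K]_(fdim N, fdim C)) :
  Phi x -> standard x N -> dom (below x) M -> is_hom e -> row_full e -> is_hom h ->
  exists2 h' : 'M[K]_(fdim N, fdim M), is_hom h' & h' *m e = h.
Proof.
move=> px /(standardP px) [P [t [p [[pP _ _ _] hp fp dN U]]]] dM he fe hh.
have [f [hf ef]] := pP _ _ e _ he fe (hom_comp hp hh).
have [h' hh' eh] := factor_epi hp fp hf (U _ _ dM hf).
by exists h' => //; apply: (row_full_inj fp); rewrite mulmxA eh ef.
Qed.

(** Stands in for uniqueness up to isomorphism: later, a surjection between modules of equal
    dimension is all that is required. *)
Lemma standard_dim x N N' : Phi x -> standard x N -> standard x N' -> fdim N = fdim N'.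
Proof.
move=> px; suff G M M' : standard x M -> standard x M' -> (fdim M' <= fdim M)%N.
  by move=> sN sN'; apply/eqP; rewrite eqn_leq !G.
move=> sM sM'; have [t [ht ft _]] := standard_top px sM.
have [t' [ht' ft' H]] := standard_top px sM'.
have [h hh eh] := standard_lift px sM (standard_dom px sM') ht' ft' ht.
rewrite -(eqP (H _ h hh _)) ?rank_leq_row // eh.
by apply: row_full_neq0 ft; exact: fdimL.
Qed.

(** The induction is on a bound k for the codimension of N. If the image of some f is not contained
    in N, let I be its image in Q/N. The preimage X of I is an extension of I by a submodule of N,
    so it still has factors in T, and it is strictly larger than N. *)
Lemma largest_dom T Q : exists N (i : 'M[K]_(fdim N, fdim Q)),
  [/\ is_hom i, row_free i, dom T N &
      forall M (f : 'M[K]_(fdim M, fdim Q)), dom T M -> is_hom f -> (f <= i)%MS].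
Proof.
suff G k : forall N (i : 'M[K]_(fdim N, fdim Q)), is_hom i -> row_free i -> dom T N ->
    (fdim Q <= fdim N + k)%N ->
    exists N (i : 'M[K]_(fdim N, fdim Q)), [/\ is_hom i, row_free i, dom T N &
      forall M (f : 'M[K]_(fdim M, fdim Q)), dom T M -> is_hom f -> (f <= i)%MS].
  have [Z [z [hz fz ez]]] := sub_exists (@submod0 _ _ Q 0).
  apply: (G (fdim Q) Z z) => //; last exact: leq_addl.
  move=> y P t _ _ _ f _; apply: fdim0_eq0.
  by rewrite -(eqP fz) ez mxrank0.
elim: k => [|k IH] N i hi fi dN bnd.
  exists N, i; split=> // M f _ _; apply: submx_full.
  by rewrite /row_full (eqP fi) eqn_leq -{1}(eqP fi) rank_leq_col -[X in (_ <= X)%N]addn0.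
case: (classic (exists M (f : 'M[K]_(fdim M, fdim Q)), [/\ dom T M, is_hom f & ~~ (f <= i)%MS])).
  move=> [M [f [dM hf nf]]].
  have [C [p [hp fp ep]]] := quo_exists (hom_submod hi).
  have [I [q [m [hq fq hm fm eqm]]]] := image_factor (hom_comp hf hp).
  have [X [a [r [[ha fa] [hr fr] ear ka]]]] := pullback hp fp hm fm.
  have [Y [b Eb]] := exact_of_epi hr fr.
  have [hb fb _ _ eb] := Eb.
  have dI : dom T I by exact: dom_epi dM.
  have bai : (b *m a <= i)%MS.
    by rewrite -ep sub_kermx -mulmxA ear mulmxA (exact_comp0 Eb) mul0mx.
  have [c hc ec] := factor_mono hi fi (hom_comp hb ha) bai.
  have fc : row_free c by apply: (@row_free_mull _ _ _ _ _ i); rewrite ec row_free_mul.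
  have dX : dom T X by apply: (dom_ext Eb) dI; exact: dom_mono dN.
  apply: (IH X a) => //.
  apply: leq_trans bnd _; rewrite -addSnnS leq_add2r.
  have /submxP [u eu] : (i <= a)%MS by rewrite ka sub_preim; have -> : i *m p = 0; [apply/eqP; rewrite -sub_kermx ep | exact: sub0mx].
  have fu : row_free u by apply: (@row_free_mull _ _ _ _ _ a); rewrite -eu.
  have ur : u *m r = 0.
    apply: (row_free_inj fm); rewrite /= mul0mx -mulmxA -ear mulmxA -eu; apply/eqP.
    by rewrite -sub_kermx ep.
  have I0 : (0 < fdim I)%N.
    rewrite lt0n; apply: contraNneq nf => d0.
    by rewrite -ep sub_kermx -eqm (fdim0_eq0 q d0) mul0mx.
  have ub : (u <= b)%MS by rewrite eb sub_kermx ur.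
  have := mxrankS ub; rewrite (eqP fu) (eqP fb) (exact_dim Eb) => leI.
  by rewrite -addn1 leq_add.
move=> H; exists N, i; split=> // M f dM hf; apply: contraT => nf.
by case: H; exists M, f.
Qed.

Lemma costandardP x N : Phi x -> costandard x N ->
  exists Q (s : 'M[K]_(fdim (L x), fdim Q)) (i : 'M[K]_(fdim N, fdim Q)),
    [/\ ihull s, is_hom i, row_free i, dom (below x) N &
        forall M (f : 'M[K]_(fdim M, fdim Q)), dom (below x) M -> is_hom f -> (f <= i)%MS].
Proof.
move=> px [Q [cQ [U [sq sf H]]]]; have [s cs] := injhullP px cQ.
have [i [hi fi ei]] := sq_iso_bot sq.
exists Q, s, i; split=> //.
  by apply/(secfactorsP (@below_Phi x) sq).
move=> M f dM hf; have [I [q [m [hq fq hm fm eqm]]]] := image_factor hf.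
have em : (m :=: <<m>>)%MS by apply: eqmx_sym; exact: genmxE.
have sqI := sq_iso_bot_intro (fdim Q) hm fm em.
have := H _ (submod_eqmx em (hom_submod hm)) (proj2 (secfactorsP (@below_Phi x) sqI) (dom_epi hq fq dM)).
by rewrite genmxE -ei -eqm => /(submx_trans _); apply; exact: submxMl.
Qed.

Lemma costandard_intro x N Q (s : 'M[K]_(fdim (L x), fdim Q)) (i : 'M[K]_(fdim N, fdim Q)) :
  Phi x -> ihull s -> is_hom i -> row_free i -> dom (below x) N ->
  (forall M (f : 'M[K]_(fdim M, fdim Q)), dom (below x) M -> is_hom f -> (f <= i)%MS) ->
  costandard x N.
Proof.
move=> px cs hi fi dN H; exists Q; split; first exact: injhull_intro cs.
have ei : (i :=: <<i>>)%MS by apply: eqmx_sym; exact: genmxE.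
have sqI := sq_iso_bot_intro (fdim Q) hi fi ei.
exists <<i>>%MS; split=> //; first by apply/(secfactorsP (@below_Phi x) sqI).
move=> U' hU' sU'; have [S [g [hg fg eg]]] := sub_exists hU'.
rewrite genmxE -eg; apply: H => //.
by apply/(secfactorsP (@below_Phi x) (sq_iso_bot_intro (fdim Q) hg fg eg)).
Qed.

End Standards.

(** * Extensions of standard by costandard modules *)

Section Extensions.
Local Open Scope ring_scope.
Set Implicit Arguments.
Unset Strict Implicit.
Variables (K : fieldType) (B : falgType K).
Implicit Types (M N X Y S C P Q Z : fmod B).
Variables (L : lab -> fmod B) (Phi : pred lab) (le : rel lab).
Hypothesis hle : poset_on Phi le.
Hypothesis hL : simples_labelled L Phi.
Hypothesis hadapted : adapted L Phi le.

Notation below := (below Phi le).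
Notation standard := (standard L Phi le).
Notation costandard := (costandard L Phi le).
Notation dom := (dom L Phi).
Notation FD := (filtered (fun N => exists2 y, Phi y & standard y N)).
Notation FN := (filtered (fun N => exists2 y, Phi y & costandard y N)).

Lemma simple_top_intro x N (r : 'M[K]_(fdim N, fdim (L x))) :
  is_hom r -> row_full r ->
  (forall X (f : 'M[K]_(fdim X, fdim N)), is_hom f -> f *m r != 0 -> row_full f) ->
  simple_top L x N.
Proof.
move=> hr fr H; exists (kermx r); split; first exact: (sq_iso_top_intro hr fr).
move=> U hU; rewrite ltmxE submx1 sub1mx /= => nf.
have [S [g [hg _ eg]]] := sub_exists hU.
rewrite -eg sub_kermx; apply: contraNT nf => /(H _ _ hg).
by rewrite (eqmx_row_full eg).
Qed.

Lemma simple_socle_intro y N (s : 'M[K]_(fdim (L y), fdim N)) :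
  is_hom s -> row_free s ->
  (forall X (f : 'M[K]_(fdim X, fdim N)), is_hom f -> f != 0 -> (s <= f)%MS) ->
  simple_socle L y N.
Proof.
move=> hs fs H; exists <<s>>%MS; split.
  exact: (sq_iso_bot_intro _ hs fs (eqmx_sym (genmxE s))).
move=> U hU rU; have [S [g [hg _ eg]]] := sub_exists hU.
by rewrite genmxE -eg; apply: H => //; rewrite -mxrank_eq0 eg.
Qed.

Lemma is_cf_in (T : pred lab) N z : (forall y, T y -> Phi y) -> Phi z -> dom T N -> is_cf N (L z) -> T z.
Proof.
move=> TP pz dN [U [V [ss sq]]].
have sqN : sq_iso N (1%:M : 'M_(fdim N)) (0 : 'M_(fdim N)) N.
  apply: (sq_iso_top_intro (@hom_1 _ _ N)); first by rewrite /row_full mxrank1.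
  by have -> : kermx (1%:M : 'M[K]_(fdim N)) = 0;
    [apply/eqP; rewrite kermx_eq0 /row_free mxrank1 | exact: eqmx_refl].
have [||y Ty sqy] := proj2 (secfactorsP hL TP sqN) dN U V _ _ ss; rewrite ?sub0mx ?submx1 //.
have hU : is_submod U by case: sq.
have [S [g [hg fg eg]]] := sub_exists hU.
have [q [hq fq eq]] := sq_isoP sq hg fg eg.
have [r [hr fr er]] := sq_isoP sqy hg fg eg.
have [|w hw ew] := factor_epi hq fq hr.
  by apply/eqP; rewrite -sub_kermx -(submxMfree _ _ fg) eq er.
suff -> : z = y by [].
apply: (homL hL pz (TP _ Ty) hw); apply/eqP => w0.
have := row_full_neq0 (fdimL hL (TP _ Ty)) fr.
by rewrite -ew w0 mulmx0 eqxx.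
Qed.

(** I contains the image of Z, which m carries into Y since k q m = f i, and the quotient by it is a
    quotient of P/Z = N. Hence every factor of I comes from Y or from N. *)
Lemma ext_image x y P N Z Y Q (p : 'M[K]_(fdim P, fdim N)) (k : 'M[K]_(fdim Z, fdim P))
  (f : 'M[K]_(fdim Z, fdim Y)) (i : 'M[K]_(fdim Y, fdim Q)) I
  (q : 'M[K]_(fdim P, fdim I)) (m : 'M[K]_(fdim I, fdim Q)) (T : pred lab) :
  exact3 k p -> is_hom f -> is_hom i -> row_free i -> is_hom q -> row_full q -> is_hom m -> row_free m ->
  k *m (q *m m) = f *m i -> dom (below x) N -> dom (below y) Y ->
  (forall z, below x z -> T z) -> (forall z, below y z -> T z) -> dom T I.
Proof.
move=> E hf hi fi hq fq hm fm e dN dY Tx Ty; have [hk _ hp fp _] := E.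
have hkq := hom_comp hk hq.
have [C [c [hc fc ec]]] := quo_exists (hom_submod hkq).
have [X [a Ea]] := exact_of_epi hc fc.
have [ha fa _ _ ea] := Ea.
have eaq : (a :=: k *m q)%MS := eqmx_trans ea ec.
have [|b hb eb] := factor_mono hi fi (hom_comp ha hm).
  by rewrite (eqmxMr m eaq) -mulmxA e submxMl.
have fb : row_free b by apply: (@row_free_mull _ _ _ _ _ i); rewrite eb row_free_mul.
have [|d hd ed] := exact_desc E (hom_comp hq hc).
  by rewrite mulmxA; apply/eqP; rewrite -sub_kermx ec.
have fd : row_full d by apply: (@row_full_mulr _ _ _ _ p); rewrite ed row_full_mul.
apply: (dom_ext Ea).
  by apply: (dom_sub _ (dom_mono hb fb dY)) => z _; exact: Ty.
by apply: (dom_sub _ (dom_epi hd fd dN)) => z _; exact: Tx.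
Qed.

(* Ext^1(Delta(x), nabla(y)) = 0.  If x and y are incomparable, a nonzero f
   would produce a module with top L_x and socle L_y violating adaptedness. *)
Lemma ext_costandard x y P N (t : 'M[K]_(fdim P, fdim (L x))) (p : 'M[K]_(fdim P, fdim N))
  Z (k : 'M[K]_(fdim Z, fdim P)) Y (f : 'M[K]_(fdim Z, fdim Y)) :
  Phi x -> Phi y -> pcover t -> dom (below x) N ->
  (forall M (f : 'M[K]_(fdim P, fdim M)), dom (below x) M -> is_hom f -> kermx p *m f = 0) ->
  exact3 k p -> costandard y Y -> is_hom f ->
  exists2 g : 'M[K]_(fdim P, fdim Y), is_hom g & k *m g = f.
Proof.
move=> px py ct dN U E cY hf; have [hk fk hp fp ek] := E.
case: (eqVneq f 0) => [->|f0].
  by exists 0; [exact: hom_0 | rewrite mulmx0].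
have [Q [s [i [cs hi fi dY max]]]] := costandardP hL py cY.
have [iQ _ _ _] := cs.
have [h [hh eh]] := iQ _ _ k _ hk fk (hom_comp hf hi).
have [I [q [m [hq fq hm fm eqm]]]] := image_factor hh.
have dT (T : pred lab) : (forall z, below x z -> T z) -> (forall z, below y z -> T z) -> dom T I.
  by move=> Tx Ty; apply: (@ext_image x y P N Z Y Q p k f i I q m T) => //; rewrite eqm.
have kh0 : k *m h != 0 by rewrite eh; exact: mul_neq0_free.
have I0 : (0 < fdim I)%N.
  rewrite lt0n; apply: contraNneq kh0 => d0.
  by rewrite -eqm (fdim0_eq0 q d0) mul0mx mulmx0.
have [rfl anti trans] := hle.
(* If all factors of I were below x, then q would factor through Delta(x) and k h would vanish. *)
have kqx : dom (below x) I -> False.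
  move=> d; move: kh0; rewrite -eqm mulmxA.
  have /eqP -> : k *m q == 0; last by rewrite mul0mx eqxx.
  have /submxP [w ->] : (k <= kermx p)%MS by rewrite ek.
  by rewrite -mulmxA U ?mulmx0.
have [xy|nxy] := boolP (le x y).
  have d : dom (below y) I.
    apply: dT => z // /andP [pz zx]; apply/andP; split=> //; exact: (trans z x y).
  have [|g hg eg] := factor_mono hi fi hh.
    by rewrite -eqm; apply: submx_trans (submxMl _ _) _; exact: max.
  by exists g => //; apply: (row_free_inj fi); rewrite /= -mulmxA eg.
have [yx|nyx] := boolP (le y x).
  case: kqx; apply: dT => z // /andP [pz zy]; apply/andP; split=> //; exact: (trans z y x).
have [r [hr fr _ Hr]] := top_desc ct hq fq I0.
have [s' [hs' fs' _ Hs']] := hull_desc (simpleL hL py) cs hm fm I0.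
have [z [pz lz cf]] := hadapted px py nxy nyx (simple_top_intro hr fr Hr) (simple_socle_intro hs' fs' Hs').
have Tz : below x z || below y z.
  apply: (@is_cf_in (fun z => below x z || below y z) I z _ pz _ cf).
    by move=> w /orP [] /andP [].
  by apply: dT => w ->; rewrite ?orbT.
(* Adaptedness puts z strictly above x or y, while the factors of I are below x or y. Two of the
   four combinations contradict antisymmetry, the other two the incomparability of x and y. *)
exfalso; move: Tz lz; rewrite /Defs.below /ltl pz /=.
case/orP=> le1 /orP [] /andP [le2 ne].
- by move/eqP: ne; apply; exact: anti.
- by case/negP: nyx; apply: (trans y z x).
- by case/negP: nxy; apply: (trans x z y).
- by move/eqP: ne; apply; exact: anti.
Qed.

(** Along the costandard filtration of Y: extend the component of f in the top quotient, lift this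
    extension to Y by projectivity of P, and correct it by extending the remaining map into X. *)
Lemma ext_FN x P N (t : 'M[K]_(fdim P, fdim (L x))) (p : 'M[K]_(fdim P, fdim N))
  Z (k : 'M[K]_(fdim Z, fdim P)) Y :
  Phi x -> pcover t -> dom (below x) N ->
  (forall M (f : 'M[K]_(fdim P, fdim M)), dom (below x) M -> is_hom f -> kermx p *m f = 0) ->
  exact3 k p -> FN Y -> forall f : 'M[K]_(fdim Z, fdim Y), is_hom f ->
  exists2 g : 'M[K]_(fdim P, fdim Y), is_hom g & k *m g = f.
Proof.
move=> px ct dN U E; elim=> {Y} [Y d0|X Y N' a b [y py cN] _ IH E'] f hf.
  by exists 0; [exact: hom_0 | rewrite (fdim0_eq0 f d0) mulmx0].
have [ha fa hb fb eab] := E'; have [hk _ _ _ _] := E; have [pP _ _ _] := ct.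
have [g1 hg1 e1] := ext_costandard px py ct dN U E cN (hom_comp hf hb).
have [g2 [hg2 e2]] := pP _ _ b g1 hb fb hg1.
have [|f' hf' ef'] := exact_lift E' (hom_sub hf (hom_comp hk hg2)).
  by rewrite mulmxBl -mulmxA e2 e1 subrr.
have [g' hg' eg'] := IH f' hf'.
exists (g2 + g' *m a); first by apply: hom_add => //; exact: hom_comp.
by rewrite mulmxDr mulmxA eg' ef' addrC subrK.
Qed.

(** A lift f of P -> N -> C sends the kernel of P -> N into Y. Extending that restriction to P and
    subtracting it gives a lift that descends to N. *)
Lemma lift_standard x N Y M C (i : 'M[K]_(fdim Y, fdim M)) (e : 'M[K]_(fdim M, fdim C)) :
  Phi x -> standard x N -> FN Y -> exact3 i e ->
  forall h : 'M[K]_(fdim N, fdim C), is_hom h ->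
  exists2 h' : 'M[K]_(fdim N, fdim M), is_hom h' & h' *m e = h.
Proof.
move=> px sN FY E h hh; have [hi fi he fe eie] := E.
have [P [t [p [ct hp fp dN U]]]] := standardP hL px sN; have [pP _ _ _] := ct.
have [f [hf ef]] := pP _ _ e _ he fe (hom_comp hp hh).
have [Z [k Ek]] := exact_of_epi hp fp; have [hk fk _ _ ek] := Ek.
have [|c hc ec] := exact_lift E (hom_comp hk hf).
  by rewrite -mulmxA ef mulmxA (exact_comp0 Ek) mul0mx.
have [d hd ed] := ext_FN px ct dN U Ek FY hc.
have [|h' hh' eh'] := exact_desc Ek (hom_sub hf (hom_comp hd hi)).
  by rewrite mulmxBr mulmxA ed ec subrr.
exists h' => //; apply: (row_full_inj fp).
by rewrite mulmxA eh' mulmxBl ef -mulmxA (exact_comp0 E) mulmx0 subr0.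
Qed.

(** Injectivity of M glues the layers: a lift on the submodule Z extends to X, and its error factors
    through the standard quotient N, where [lift_standard] applies. *)
Lemma lift_FD X Y M C (i : 'M[K]_(fdim Y, fdim M)) (e : 'M[K]_(fdim M, fdim C)) :
  FD X -> FN Y -> Defs.injective M -> exact3 i e ->
  forall h : 'M[K]_(fdim X, fdim C), is_hom h ->
  exists2 h' : 'M[K]_(fdim X, fdim M), is_hom h' & h' *m e = h.
Proof.
move=> + FY iM E; elim=> {X} [X d0|Z X N a b [x px sN] _ IH E'] h hh.
  exists 0; first exact: hom_0.
  by apply/eqP; rewrite mul0mx eq_sym -mxrank_eq0 -leqn0 -d0 rank_leq_row.
have [ha fa hb fb eab] := E'; have [_ _ he _ _] := E.
have [g hg eg] := IH _ (hom_comp ha hh).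
have [g' [hg' eg']] := iM _ _ a g ha fa hg.
have [|c hc ec] := exact_desc E' (hom_sub hh (hom_comp hg' he)).
  by rewrite mulmxBr mulmxA eg' eg subrr.
have [d hd ed] := lift_standard px sN FY E hc.
exists (g' + b *m d); first by apply: hom_add => //; exact: hom_comp.
by rewrite mulmxDl -mulmxA ed ec addrC subrK.
Qed.

(* Pulling a test diagram back to a projective P replaces an arbitrary
   inclusion by one of the form X' -> P, where X' has a standard filtration. *)
Lemma quotient_injective Y M C (i : 'M[K]_(fdim Y, fdim M)) (e : 'M[K]_(fdim M, fdim C)) :
  (forall P X (a : 'M[K]_(fdim X, fdim P)), projective P -> is_hom a -> row_free a -> FD X) ->
  FN Y -> Defs.injective M -> exact3 i e -> Defs.injective C.
Proof.
move=> subFD FY iM E X Z g h hg fg hh; have [_ _ he _ _] := E.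
have [P [q [pP hq fq]]] := enough_projectives Z.
have [X' [a [r [[ha fa] [hr fr] ear ka]]]] := pullback hq fq hg fg.
have [w hw ew] := lift_FD (subFD _ _ a pP ha fa) FY iM E (hom_comp hr hh).
have [w' [hw' ew']] := iM _ _ a w ha fa hw.
have aw : a *m (w' *m e) = r *m h by rewrite mulmxA ew' ew.
have [|h' hh' eh'] := factor_epi hq fq (hom_comp hw' he).
  have /submxP [u eu] : (kermx q <= a)%MS by rewrite ka sub_preim mulmx_ker sub0mx.
  have ur : u *m r = 0.
    by apply: (row_free_inj fg); rewrite /= mul0mx -mulmxA -ear mulmxA -eu mulmx_ker.
  by rewrite eu -mulmxA aw mulmxA ur mul0mx.
exists h'; split=> //; apply: (row_full_inj fr).
by rewrite mulmxA -ear -mulmxA eh' aw.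
Qed.

End Extensions.

(** * Ultra strongly quasihereditary algebras *)

Section UltraStrong.
Local Open Scope ring_scope.
Set Implicit Arguments.
Unset Strict Implicit.
Variables (K : fieldType) (B : falgType K) (n : nat) (l : nat -> nat).
Implicit Types (M N X Y S C P Q Z : fmod B) (i j k : nat).
Variables (le : rel lab) (L : lab -> fmod B).
Notation Phi := (inPhi n l).
Notation below := (below Phi le).
Notation standard := (standard L Phi le).
Notation costandard := (costandard L Phi le).
Notation dom := (dom L Phi).
Notation FD := (filtered (fun N => exists2 y, Phi y & standard y N)).
Notation FN := (filtered (fun N => exists2 y, Phi y & costandard y N)).

Hypothesis hl : forall i, (1 <= i <= n -> 0 < l i)%N.
Hypothesis hle : poset_on Phi le.
Hypothesis hL : simples_labelled L Phi.
Hypothesis husq : ultra_strongly_qh L Phi le.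
Hypothesis hlt : forall i j, Phi (i, j) -> (j < l i)%N -> ltl le (i, j.+1) (i, j).
Hypothesis hrad : forall i j, Phi (i, j) -> (j < l i)%N ->
  forall (N : fmod B) (R : 'M[K]_(fdim N)) (N' : fmod B),
    standard (i, j) N -> is_rad R -> standard (i, j.+1) N' ->
    sq_iso N R (0 : 'M[K]_(fdim N)) N'.
Hypothesis hbase : forall i (N : fmod B), (1 <= i <= n)%N ->
  standard (i, l i) N -> iso N (L (i, l i)).

(** * Radicals and submodules of standard modules *)

Lemma is_rad_top x N (t : 'M[K]_(fdim N, fdim (L x))) :
  Phi x -> is_hom t -> row_full t ->
  (forall X (f : 'M[K]_(fdim X, fdim N)), is_hom f -> f *m t != 0 -> row_full f) ->
  is_rad (kermx t).
Proof.
move=> px ht ft H.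
have max : simple_sec N (1%:M : 'M_(fdim N)) (kermx t).
  apply: (simple_sec_intro (simpleL hL px)).
  exact: (sq_iso_top_intro ht ft).
split; first exact: ker_submod.
  move=> U [_ hU ltU H1].
  have [S [g [hg fg eg]]] := sub_exists hU.
  (* A submodule not killed by t is everything, so the kernel of t is the only maximal submodule. *)
  have Uk : (U <= kermx t)%MS.
    rewrite -eg sub_kermx; apply: contraLR ltU => n0.
    by rewrite ltmxE submx1 sub1mx /= -(eqmx_row_full eg) H.
  have [/andP []//|/andP [_ k1]] := H1 _ (ker_submod ht) Uk (submx1 _).
  have := row_full_neq0 (fdimL hL px) ft.
  by rewrite -{1}[t]mul1mx -sub_kermx k1.
by move=> v; apply.
Qed.

Lemma standard_rad i j N N' (t : 'M[K]_(fdim N, fdim (L (i, j)))) :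
  Phi (i, j) -> (j < l i)%N -> standard (i, j) N -> standard (i, j.+1) N' ->
  is_hom t -> row_full t ->
  (forall X (f : 'M[K]_(fdim X, fdim N)), is_hom f -> f *m t != 0 -> row_full f) ->
  exists g : 'M[K]_(fdim N', fdim N), [/\ is_hom g, row_free g & (g :=: kermx t)%MS].
Proof.
move=> px lt sN sN' ht ft H; apply: sq_iso_bot.
by apply: hrad sN'; [| | exact: sN | exact: is_rad_top ft H].
Qed.

Lemma standard_socle_free i N (t : 'M[K]_(fdim N, fdim (L (i, l i)))) :
  (1 <= i <= n)%N -> standard (i, l i) N -> row_full t -> row_free t.
Proof.
move=> hi sN /eqP ft; have [f [_ /eqP ff /eqP fu]] := isoP (hbase hi sN).
by rewrite /row_free ft -fu ff.
Qed.

Lemma Phi_le i j k : Phi (i, j) -> (j <= k <= l i)%N -> Phi (i, k).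
Proof.
move=> /andP [hi /andP [/= j0 _]] /andP [jk kl]; apply/andP; split=> //=.
by rewrite (leq_trans j0 jk).
Qed.

Lemma standard_homL x y N (f : 'M[K]_(fdim N, fdim (L y))) :
  Phi x -> Phi y -> standard x N -> is_hom f -> f != 0 -> x = y.
Proof.
move=> px py sN hf f0; have [P [t [p [ct hp fp _ _]]]] := standardP hL px sN.
exact: (pcover_homL hL px py ct (hom_comp hp hf) (mul_neq0_full fp f0)).
Qed.

(** A map into Delta(i,j) is onto unless it lands in the radical, which is Delta(i,j+1); the
    recursion ends at the simple module Delta(i,l_i). *)
Lemma standard_submodule i j N : Phi (i, j) -> standard (i, j) N ->
  forall X (f : 'M[K]_(fdim X, fdim N)), is_hom f -> f != 0 ->
  exists k N' (q : 'M[K]_(fdim X, fdim N')) (g : 'M[K]_(fdim N', fdim N)),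
    [/\ (j <= k <= l i)%N /\ standard (i, k) N', is_hom q, row_full q, is_hom g /\ row_free g & q *m g = f].
Proof.
move: {2}(l i - j)%N (erefl (l i - j)%N) => d; elim: d j N => [|d IH] j N ed px sN X f hf f0.
  have jl : j = l i.
    apply/eqP; rewrite eqn_leq -[X in _ && X]subn_eq0 ed eqxx andbT.
    by case/andP: px => _ /andP [].
  move: ed px sN f hf f0; rewrite jl => _ px sN f hf f0.
  have [t [ht ft H]] := standard_top hle hL px sN.
  have ift : row_free t by apply: standard_socle_free ft => //; case/andP: px.
  exists (l i), N, f, 1%:M; split; rewrite ?mulmx1 //.
  - by split=> //; rewrite leqnn.
  - by apply: H => //; exact: mul_neq0_free.
  - by split; [exact: hom_1 | rewrite /row_free mxrank1].
have jl : (j < l i)%N by rewrite -subn_gt0 ed.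
have [t [ht ft H]] := standard_top hle hL px sN.
case: (eqVneq (f *m t) 0) => [ft0|ftn0]; last first.
  exists j, N, f, 1%:M; split; rewrite ?mulmx1 //.
  - by rewrite leqnn (ltnW jl).
  - exact: H.
  - by split; [exact: hom_1 | rewrite /row_free mxrank1].
have px' : Phi (i, j.+1) by apply: Phi_le px _; rewrite leqnSn.
have [N1 sN1] := standard_exists le hL px'.
have [g [hg fg eg]] := standard_rad px jl sN sN1 ht ft H.
have [|f' hf' ef'] := factor_mono hg fg hf; first by rewrite eg sub_kermx ft0.
have f'0 : f' != 0 by apply: contraNneq f0 => e; rewrite -ef' e mul0mx.
have [|k [N' [q [g' [[/andP [jk kl] sN'] hq fq [hg' fg'] eq]]]]] := IH _ _ _ px' sN1 X f' hf' f'0.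
  by rewrite subnS ed.
exists k, N', q, (g' *m g); split=> //.
- by rewrite (ltnW jk) kl.
- by split; [exact: hom_comp | exact: row_free_mul].
- by rewrite mulmxA eq.
Qed.

(** Composes the inclusions of successive radicals. The case k = j is not trivial: N and N' are then
    two models of the same standard module. *)
Lemma standard_chain i j k N N' :
  Phi (i, j) -> standard (i, j) N -> (j <= k <= l i)%N -> standard (i, k) N' ->
  exists g : 'M[K]_(fdim N', fdim N), is_hom g /\ row_free g.
Proof.
move: {2}(k - j)%N (erefl (k - j)%N) => d.
elim: d j N => [|d IH] j N ed px sN /andP [jk kl] sN'.
  have ekj : k = j by apply/eqP; rewrite eqn_leq -subn_eq0 ed jk.
  move: sN'; rewrite ekj => sN'.
  have [t [ht ft H]] := standard_top hle hL px sN.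
  have [t' [ht' ft' H']] := standard_top hle hL px sN'.
  have [h hh eh] := standard_lift hL px sN' (standard_dom hL px sN) ht ft ht'.
  exists h; split=> //.
  have fh : row_full h by apply: H => //; rewrite eh; apply: row_full_neq0 ft'; exact: (fdimL hL px).
  by apply/eqP; rewrite (eqP fh) (standard_dim hle hL px sN sN').
have jk' : (j < k)%N by rewrite -subn_gt0 ed.
have jl : (j < l i)%N by exact: leq_trans kl.
have px' : Phi (i, j.+1) by apply: Phi_le px _; rewrite leqnSn.
have [N1 sN1] := standard_exists le hL px'.
have [t [ht ft H]] := standard_top hle hL px sN.
have [g [hg fg _]] := standard_rad px jl sN sN1 ht ft H.
have [||g' [hg' fg']] := IH j.+1 N1 _ px' sN1 _ sN'.
- by rewrite subnS ed.
- by rewrite jk' kl.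
by exists (g' *m g); split; [exact: hom_comp | exact: row_free_mul].
Qed.

(** The image of S in the top layer is zero or again standard by [standard_submodule], and the
    kernel embeds into the rest X of the filtration. *)
Lemma FD_sub M : FD M -> forall S (s : 'M[K]_(fdim S, fdim M)), is_hom s -> row_free s -> FD S.
Proof.
elim=> {M} [M d0|X M N f p [[i j] px sN] _ IH E] S s hs fs.
  apply: filtered0; apply/eqP; rewrite -leqn0 -d0 -(eqP fs); exact: rank_leq_col.
have [hf ff hp fp _] := E.
case: (eqVneq (s *m p) 0) => [sp0|spn0].
  have [s' hs' es'] := exact_lift E hs sp0.
  by apply: (IH S s') => //; apply: (@row_free_mull _ _ _ _ _ f); rewrite es'.
have [k [N' [q [g [[jk sN'] hq fq [hg fg] eq]]]]] := standard_submodule px sN (hom_comp hs hp) spn0.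
have [Y [a Ea]] := exact_of_epi hq fq; have [ha fa _ _ _] := Ea.
have [|c hc ec] := exact_lift E (hom_comp ha hs).
  by rewrite -mulmxA -eq mulmxA (exact_comp0 Ea) mul0mx.
apply: (filteredS _ _ Ea).
  by exists (i, k) => //; exact: Phi_le px jk.
apply: (IH Y c) => //; apply: (@row_free_mull _ _ _ _ _ f).
by rewrite ec row_free_mul.
Qed.

Lemma projective_FD P X (a : 'M[K]_(fdim X, fdim P)) :
  projective P -> is_hom a -> row_free a -> FD X.
Proof.
move=> pP ha fa; case: husq => [[_ _ H] _ _].
exact: (FD_sub (filt_by_filtered (H P pP)) ha fa).
Qed.

(** * The injective hull of the simple module L_(i,l_i) *)

Section Hull.
Variables (i : nat) (Q : fmod B) (s : 'M[K]_(fdim (L (i, l i)), fdim Q)).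
Hypothesis hi : (1 <= i <= n)%N.
Hypothesis hs : ihull s.

Lemma Phi_bot : Phi (i, l i).
Proof. by rewrite /inPhi /= hi leqnn hl. Qed.

(** Delta(i,l_i) is simple, so its radical vanishes and (A2) applies. *)
Lemma hull_FD : FD Q.
Proof.
have [N sN] := standard_exists le hL Phi_bot.
have [t [ht ft H]] := standard_top hle hL Phi_bot sN.
have it := standard_socle_free hi sN ft.
case: husq => _ _ /(_ _ N (kermx t) Q Phi_bot sN (is_rad_top Phi_bot ht ft H)) HQ.
apply: filt_by_filtered; apply: HQ; last exact: (injhull_intro hL Phi_bot hs).
by apply/eqP; rewrite mxrank_eq0 kermx_eq0.
Qed.

(* U surjects onto some Delta(w), and one of f, g maps onto it, so w = z and that
   map splits the surjection; the kernel vanishes as U has a simple socle. *)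
Lemma generated_sub z N U (u : 'M[K]_(fdim U, fdim Q)) (f g : 'M[K]_(fdim N, fdim U)) :
  Phi z -> standard z N -> is_hom u -> row_free u -> is_hom f -> is_hom g ->
  (1%:M <= f + g)%MS -> (0 < fdim U)%N ->
  (row_free f /\ row_full f) \/ (row_free g /\ row_full g).
Proof.
move=> pz sN hu fu hf hg fg U0.
have sS := simpleL hL Phi_bot.
case: (filtered_inv (FD_sub hull_FD hu fu)) => [d0|[X [N1 [a [p [[w pw sN1] _ E]]]]]].
  by rewrite d0 in U0.
have [ha fa hp fp ea] := E.
have [t [ht ft H]] := standard_top hle hL pw sN1.
have hpt := hom_comp hp ht.
have G h : is_hom h -> h *m (p *m t) != 0 -> row_free h /\ row_full (h : 'M[K]_(fdim N, _)).
  move=> hh n0.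
  have ezw := standard_homL pz pw sN (hom_comp hh hpt) n0.
  rewrite -ezw in sN1; have dN := standard_dim hle hL pz sN sN1.
  have fhp : row_full (h *m p) by apply: H; [exact: hom_comp | rewrite -mulmxA].
  have ihp : row_free (h *m p) by apply/eqP; rewrite (eqP fhp) dN.
  have ih : row_free h by apply: row_free_mull ihp.
  have X0 : fdim X = 0%N.
    apply/eqP; apply: contraT; rewrite -lt0n => X0.
    have N0 := standard_fdim_gt0 hle hL pz sN.
    have s1 := hull_sub sS hs (hom_comp ha hu) (row_free_neq0 X0 (row_free_mul fa fu)).
    have s2 := hull_sub sS hs (hom_comp hh hu) (row_free_neq0 N0 (row_free_mul ih fu)).
    case/submxP: s1 => v1 e1; case/submxP: s2 => v2 e2.
    have e12 : v1 *m a = v2 *m h.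
      by apply: (row_free_inj fu); rewrite /= -!mulmxA -e1 -e2.
    have v20 : v2 = 0.
      apply: (row_free_inj ihp); rewrite /= mul0mx mulmxA -e12 -mulmxA.
      by rewrite (exact_comp0 E) mulmx0.
    have [_ _ fs _] := hs.
    by have := row_free_neq0 (fdimL hL Phi_bot) fs; rewrite e2 v20 mul0mx eqxx.
  by split=> //; rewrite /row_full (eqP ih) (exact_dim E) X0 dN.
case: (eqVneq (f *m (p *m t)) 0) => [f0|]; last by left; exact: G.
case: (eqVneq (g *m (p *m t)) 0) => [g0|]; last by right; exact: G.
have := row_full_neq0 (fdimL hL pw) (row_full_mul fp ft).
have : (1%:M *m (p *m t) <= f *m (p *m t) + g *m (p *m t))%MS by rewrite -addsmxMr submxMr.
rewrite f0 g0 mul1mx => le0 /negP []; rewrite -submx0.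
by apply: submx_trans le0 _; rewrite addsmx_sub !sub0mx.
Qed.

(** The case of [generated_sub] where both maps are the surjection onto the image of f. *)
Lemma hull_hom_free z N (f : 'M[K]_(fdim N, fdim Q)) :
  Phi z -> standard z N -> is_hom f -> f != 0 -> row_free f.
Proof.
move=> pz sN hf f0.
have [U [q [u [hq fq hu fu equ]]]] := image_factor hf.
have U0 : (0 < fdim U)%N.
  by rewrite lt0n; apply: contraNneq f0 => d0; rewrite -equ (fdim0_eq0 q d0) mul0mx.
have le1 : (1%:M <= q + q)%MS by apply: submx_trans (addsmxSl _ _); rewrite sub1mx.
by case: (generated_sub pz sN hu fu hq hq le1 U0) => [] [iq _]; rewrite -equ row_free_mul.
Qed.

(** Apply [generated_sub] to the sum of the two images: one of them is the whole sum, and both have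
    dimension dim N. *)
Lemma hull_hom_image z N (f g : 'M[K]_(fdim N, fdim Q)) :
  Phi z -> standard z N -> is_hom f -> is_hom g -> f != 0 -> g != 0 -> (f :=: g)%MS.
Proof.
move=> pz sN hf hg f0 g0.
have ff := hull_hom_free pz sN hf f0; have fg := hull_hom_free pz sN hg g0.
have [U [u [hu fu eu]]] := sub_exists (submod_add (hom_submod hf) (hom_submod hg)).
have [|f' hf' ef] := factor_mono hu fu hf; first by rewrite eu addsmxSl.
have [|g' hg' eg] := factor_mono hu fu hg; first by rewrite eu addsmxSr.
have U0 : (0 < fdim U)%N.
  by rewrite lt0n; apply: contraNneq f0 => d0; rewrite -ef (fdim0_eq0 f' d0) mul0mx.
have le1 : (1%:M <= f' + g')%MS.
  by rewrite -(submxMfree _ _ fu) mul1mx addsmxMr ef eg eu.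
case: (generated_sub pz sN hu fu hf' hg' le1 U0) => [] [_ full].
  apply: eqmx_sym; apply/eqmxP; rewrite -mxrank_leqif_eq ?(eqP ff) ?(eqP fg) //.
  by rewrite -eg -ef; apply: submxMr; exact: submx_full.
apply/eqmxP; rewrite -mxrank_leqif_eq ?(eqP ff) ?(eqP fg) //.
by rewrite -eg -ef; apply: submxMr; exact: submx_full.
Qed.

(** Delta(z) embeds in Q, so it contains L_(i,l_i). This submodule is some Delta(z.1,k), whose top
    L_(z.1,k) must then be L_(i,l_i). *)
Lemma hull_hom_index z N (f : 'M[K]_(fdim N, fdim Q)) :
  Phi z -> standard z N -> is_hom f -> f != 0 -> z.1 = i.
Proof.
case: z => z1 z2 pz sN hf f0; have ff := hull_hom_free pz sN hf f0.
have [_ hs' fs _] := hs; have L0 := fdimL hL Phi_bot.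
have [v hv ev] := factor_mono hf ff hs' (hull_sub (simpleL hL Phi_bot) hs hf f0).
have v0 : v != 0.
  by apply: contraTneq (row_free_neq0 L0 fs) => e; rewrite -ev e mul0mx eqxx.
have [k [N' [q [g [[jk sN'] hq fq _ _]]]]] := standard_submodule pz sN hv v0.
have pk := Phi_le pz jk.
have [t [ht ft _]] := standard_top hle hL pk sN'.
have n0 : q *m t != 0 by apply: row_full_neq0 (row_full_mul fq ft); exact: (fdimL hL pk).
by have [->] := homL hL Phi_bot pk (hom_comp hq ht) n0.
Qed.

(** Delta(i,j) contains Delta(i,l_i), a copy of L_(i,l_i); its embedding in Q extends by
    injectivity. *)
Lemma hull_hom_exists j N : (1 <= j <= l i)%N -> standard (i, j) N ->
  exists f : 'M[K]_(fdim N, fdim Q), is_hom f /\ f != 0.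
Proof.
move=> /andP [j1 jl] sN; have px : Phi (i, j) by rewrite /inPhi /= hi j1 jl.
have [N' sN'] := standard_exists le hL Phi_bot.
have [|g [hg fg]] := standard_chain px sN _ sN'; first by rewrite jl leqnn.
have [t [ht ft _]] := standard_top hle hL Phi_bot sN'.
have it := standard_socle_free hi sN' ft.
have [iQ hs' fs _] := hs.
have [f [hf ef]] := iQ _ _ g _ hg fg (hom_comp ht hs').
exists f; split=> //; apply: contraTneq (row_free_neq0 (standard_fdim_gt0 hle hL Phi_bot sN') (row_free_mul it fs)).
by move=> e; rewrite -ef e mulmx0 eqxx.
Qed.

(* Empty for j > l i, so that the largest submodule with factors in
   [trunc (l i).+1] is zero. *)
Definition trunc j : pred lab := fun z => (j <= l i)%N && below (i, j) z.

Lemma truncE j : (j <= l i)%N -> trunc j =1 below (i, j).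
Proof. by move=> jl z; rewrite /trunc jl. Qed.

Lemma label_le j k : Phi (i, j) -> (j <= k <= l i)%N -> le (i, k) (i, j).
Proof.
move=> px /andP []; have [rfl _ trans] := hle.
elim: k => [|k IH]; first by rewrite leqn0 => /eqP <- _; exact: rfl.
rewrite leq_eqVlt => /orP [/eqP <- _|jk kl]; first exact: rfl.
have pk : Phi (i, k) by apply: (Phi_le px); rewrite -ltnS jk ltnW.
have pk1 : Phi (i, k.+1) by apply: (Phi_le px); rewrite (leq_trans _ jk) // ltnW.
have /andP [le1 _] := hlt pk kl.
by apply: (trans _ (i, k)) => //; apply: IH => //; exact: ltnW.
Qed.

Lemma trunc_below j k z : Phi (i, k) -> (1 <= j <= k)%N -> below (i, k) z -> trunc j z.
Proof.
move=> pk /andP [j1 jk] /andP [pz lz]; have [_ _ trans] := hle.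
have kl : (k <= l i)%N by case/andP: pk => _ /andP [].
have pj : Phi (i, j) by rewrite /inPhi /= hi j1 (leq_trans jk kl).
rewrite /trunc (leq_trans jk kl) /Defs.below pz /=.
by apply: (trans _ (i, k)) => //; apply: label_le; rewrite ?jk.
Qed.

Lemma trunc_succ j z : Phi (i, j) -> trunc j.+1 z -> trunc j z.
Proof.
move=> px /andP [jl bz]; apply: (@trunc_below j j.+1) => //.
  by apply: (Phi_le px); rewrite leqnSn.
by case/andP: px => _ /andP [/= -> _]; rewrite leqnSn.
Qed.

Lemma trunc_not j : Phi (i, j) -> ~~ trunc j.+1 (i, j).
Proof.
move=> px; apply/negP => /andP [jl /andP [_ l1]]; have [_ anti _] := hle.
have /andP [l2 /negP] := hlt px jl; apply; apply/eqP; apply: anti => //.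
by apply: (Phi_le px); rewrite leqnSn.
Qed.

Definition largest (T : pred lab) M (m : 'M[K]_(fdim M, fdim Q)) :=
  [/\ is_hom m, row_free m, dom T M &
      forall X (f : 'M[K]_(fdim X, fdim Q)), dom T X -> is_hom f -> (f <= m)%MS].

Lemma adapted_usq : adapted L Phi le.
Proof. by case: husq => [[]]. Qed.

(** The map Delta(z) -> L_z -> C lifts to a nonzero map into Q, whence z.1 = i. If z.2 were larger
    than j, all factors of Delta(z) would lie in [trunc j.+1]; the lift would land in M and vanish
    in C. *)
Lemma socle_lift j M C (m : 'M[K]_(fdim M, fdim Q)) (p : 'M[K]_(fdim Q, fdim C))
  z (h : 'M[K]_(fdim (L z), fdim C)) :
  (j <= l i)%N -> largest (trunc j.+1) m -> FN M -> exact3 m p -> Phi z -> is_hom h -> h != 0 ->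
  [/\ z.1 = i, (1 <= z.2 <= j)%N &
    forall N (t : 'M[K]_(fdim N, fdim (L z))), standard z N -> is_hom t ->
      exists2 f : 'M[K]_(fdim N, fdim Q), is_hom f & f *m p = t *m h].
Proof.
move=> jl [hm fm dM max] FM E pz hh h0.
have lift N (t : 'M[K]_(fdim N, fdim (L z))) : standard z N -> is_hom t ->
    exists2 f : 'M[K]_(fdim N, fdim Q), is_hom f & f *m p = t *m h.
  by move=> sN ht; exact: (lift_standard hle hL adapted_usq pz sN FM E (hom_comp ht hh)).
have [N sN] := standard_exists le hL pz.
have [t [ht ft _]] := standard_top hle hL pz sN.
have [f hf ef] := lift N t sN ht.
have th0 : t *m h != 0 by exact: mul_neq0_full.
have f0 : f != 0 by apply: contraNneq th0 => e; rewrite -ef e mul0mx.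
have z1 := hull_hom_index pz sN hf f0.
case: z pz z1 h hh h0 lift sN t ht ft ef th0 => z1 k /= pz ez h hh h0 lift sN t ht ft ef th0.
subst z1.
have [k1 kl] : (1 <= k)%N /\ (k <= l i)%N by case/andP: pz => _ /andP [].
split=> //; rewrite k1 leqNgt; apply: contraNN th0 => jk.
rewrite -ef -sub_kermx; have [_ _ _ _ <-] := E; apply: max => //.
apply: (dom_sub _ (standard_dom hL pz sN)) => w _.
by apply: trunc_below.
Qed.

(** With j = 0, a simple submodule of C would have a label with 1 <= z.2 <= 0. *)
Lemma top_fdim0 M C (m : 'M[K]_(fdim M, fdim Q)) (p : 'M[K]_(fdim Q, fdim C)) :
  largest (trunc 1) m -> FN M -> exact3 m p -> fdim C = 0%N.
Proof.
move=> lm FM E; apply/eqP; apply: contraT; rewrite -lt0n => C0.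
have [S [c [sS hc fc]]] := simple_sub_exists C0.
have [z pz [f [hf ff fuf]]] := simple_label hL sS.
have [g [hg _ _ fg _]] := iso_inv hf ff fuf.
have n0 := row_free_neq0 (fdimL hL pz) (row_free_mul fg fc).
have [_ /andP [z1 z0] _] := socle_lift (leq0n _) lm FM E pz (hom_comp hg hc) n0.
by rewrite leqNgt z1 in z0.
Qed.

Lemma quotient_hull j M C (m : 'M[K]_(fdim M, fdim Q)) (p : 'M[K]_(fdim Q, fdim C)) :
  (1 <= j <= l i)%N -> largest (trunc j.+1) m -> FN M -> exact3 m p ->
  exists c : 'M[K]_(fdim (L (i, j)), fdim C), ihull c.
Proof.
move=> jj lm FM E; have [hm fm dM max] := lm; have [_ _ hp fp ep] := E.
have [j1 jl] := andP jj; have px : Phi (i, j) by rewrite /inPhi /= hi j1 jl.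
have [N sN] := standard_exists le hL px.
have [t [ht ft Ht]] := standard_top hle hL px sN.
(* The top L_(i,j) keeps Delta(i,j) from embedding in a module with factors in [trunc j.+1], in
   particular in M. *)
have small X (f : 'M[K]_(fdim N, fdim X)) : is_hom f -> row_free f -> ~ dom (trunc j.+1) X.
  move=> hf ff /(dom_mono hf ff) dN.
  by case/negP: (trunc_not px); exact: (domL_inv hL px (dom_epi ht ft dN)).
have [f [hf f0]] := hull_hom_exists jj sN.
have ff := hull_hom_free px sN hf f0.
have nfp X (g : 'M[K]_(fdim N, fdim Q)) : is_hom g -> row_free g -> g *m p != 0.
  move=> hg fg; apply/eqP => e0.
  have [g' hg' eg'] := exact_lift E hg e0.
  by apply: (small _ g' hg' _ dM); apply: (@row_free_mull _ _ _ _ _ m); rewrite eg'.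
(* Let u : Delta(i,k) -> Q lift a simple submodule L_(i,k) of C, with k <= j. Its restriction to
   Delta(i,j) is injective, hence nonzero modulo M, so Delta(i,j) maps nontrivially to L_(i,k); thus
   k = j. *)
have img z (h : 'M[K]_(fdim (L z), fdim C)) : Phi z -> is_hom h -> h != 0 ->
    z = (i, j) /\ (h :=: f *m p)%MS.
  move=> pz hh h0.
  have [z1 /andP [z2 zj] lift] := socle_lift jl lm FM E pz hh h0.
  case: z pz z1 z2 zj h hh h0 lift => z1 k /= pz ez k1 kj h hh h0 lift.
  subst z1.
  have [Nz sNz] := standard_exists le hL pz.
  have [|g [hg fg]] := standard_chain pz sNz _ sN; first by rewrite kj jl.
  have [tz [htz ftz _]] := standard_top hle hL pz sNz.
  have [u hu eu] := lift Nz tz sNz htz.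
  have u0 : u != 0.
    by apply: contraTneq (mul_neq0_full ftz h0) => e; rewrite -eu e mul0mx eqxx.
  have fu := hull_hom_free pz sNz hu u0.
  have gt0 : g *m tz != 0.
    apply: contraNneq (nfp N _ (hom_comp hg hu) (row_free_mul fg fu)) => e.
    by rewrite -mulmxA eu mulmxA e mul0mx.
  have ekj := standard_homL px pz sN (hom_comp hg htz) gt0.
  split=> //; case: ekj => ekj.
  subst k.
  (* For label (i,j), the lift v and the fixed map f have the same image in Q, so h and [f *m p]
     have the same image in C. *)
  have [v hv ev] := lift N t sN ht.
  have v0 : v != 0.
    by apply: contraTneq (mul_neq0_full ft h0) => e; rewrite -ev e mul0mx eqxx.
  apply: eqmx_trans (eqmx_sym (eqmxMfull h ft)) _; rewrite -ev.
  exact: eqmxMr (hull_hom_image px sN hv hf v0 f0).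
have C0 : (0 < fdim C)%N.
  rewrite lt0n; apply: contraNneq (nfp N _ hf ff) => d0.
  by rewrite (fdim0_eq0 p d0) mulmx0.
have base X (x : 'M[K]_(fdim X, fdim C)) : is_hom x -> row_free x -> (0 < fdim X)%N ->
    exists h : 'M[K]_(fdim (L (i, j)), fdim C), [/\ is_hom h, row_free h & (h <= x)%MS].
  move=> hx fx X0.
  have [S [c [sS hc fc]]] := simple_sub_exists X0.
  have [z pz [d [hd fd fud]]] := simple_label hL sS.
  have [g [hg _ _ fg _]] := iso_inv hd fd fud.
  have fgcx := row_free_mul (row_free_mul fg fc) fx.
  have hgcx := hom_comp (hom_comp hg hc) hx.
  have [ez _] := img z _ pz hgcx (row_free_neq0 (fdimL hL pz) fgcx).
  subst z.
  by exists (g *m c *m x); split=> //; exact: submxMl.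
have [|c [hc fc _]] := base C 1%:M (@hom_1 _ _ C) _ C0; first by rewrite /row_free mxrank1.
exists c; split=> //.
  apply: (quotient_injective hle hL adapted_usq projective_FD FM _ E).
  by case: hs.
(* A nonzero kernel of d would contain a simple submodule of C; all of these equal the image of c,
   so d would kill c. *)
move=> X d hd n0; apply: contraT => nf.
have [Y [y [hy fy ey]]] := ker_exists hd.
have Y0 : (0 < fdim Y)%N by rewrite -(eqP fy) ey lt0n mxrank_eq0 kermx_eq0.
have [h [hh fh hle']] := base Y y hy fy Y0.
have L0 := fdimL hL px.
have [_ e1] := img _ _ px hh (row_free_neq0 L0 fh).
have [_ e2] := img _ _ px hc (row_free_neq0 L0 fc).
case/negP: n0; rewrite -sub_kermx -ey; apply: submx_trans hle'.
by rewrite e1 e2.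
Qed.

Lemma truncation_step j M M' (m : 'M[K]_(fdim M, fdim Q)) (m' : 'M[K]_(fdim M', fdim Q)) :
  (1 <= j <= l i)%N -> largest (trunc j) m -> largest (trunc j.+1) m' -> FN M' ->
  exists N (b : 'M[K]_(fdim M', fdim M)) (r : 'M[K]_(fdim M, fdim N)),
    [/\ costandard (i, j) N, exact3 b r & b *m m = m'].
Proof.
move=> jj [hm fm dM maxM] lm' FM'; have [hm' fm' dM' maxM'] := lm'.
have [j1 jl] := andP jj; have px : Phi (i, j) by rewrite /inPhi /= hi j1 jl.
have dbelow X : dom (trunc j) X <-> dom (below (i, j)) X.
  by split; apply: dom_sub => z _; rewrite truncE.
have dM'j : dom (trunc j) M' by apply: (dom_sub _ dM') => z _; exact: trunc_succ.
have [C [p [hp fp ep]]] := quo_exists (hom_submod hm').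
have E : exact3 m' p by split=> //; exact: eqmx_sym.
have [c hc] := quotient_hull jj lm' FM' E.
have [N [io [hio fio dN maxN]]] := largest_dom L Phi (below (i, j)) C.
have [r hr er] := factor_mono hio fio (hom_comp hm hp) (maxN _ _ (proj1 (dbelow _) dM) (hom_comp hm hp)).
have [b hb eb] := factor_mono hm fm hm' (maxM _ _ dM'j hm').
(* X is the preimage of nabla(i,j) in Q. As an extension of nabla(i,j) by a submodule of M' it has
   factors in [trunc j], so it lies in M, and M maps onto nabla(i,j). *)
have [X [a [r' [[ha fa] [hr' fr'] ear ea]]]] := pullback hp fp hio fio.
have [Y [k Ek]] := exact_of_epi hr' fr'.
have [hk fk _ _ _] := Ek.
have [|k' hk' ek'] := exact_lift E (hom_comp hk ha).
  by rewrite -mulmxA ear mulmxA (exact_comp0 Ek) mul0mx.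
have fk' : row_free k' by apply: (@row_free_mull _ _ _ _ _ m'); rewrite ek' row_free_mul.
have dX : dom (trunc j) X.
  by apply: (dom_ext Ek (dom_mono hk' fk' dM'j)); apply/dbelow.
have /submxP [w ew] := maxM _ _ dX ha.
have er' : r' = w *m r.
  by apply: (row_free_inj fio); rewrite /= -ear ew -!mulmxA er.
exists N, b, r; split=> //; first exact: (costandard_intro hL px hc hio fio dN maxN).
split=> //.
- by apply: (@row_free_mull _ _ _ _ _ m); rewrite eb.
- by apply: (@row_full_mulr _ _ _ _ w); rewrite -er'.
have br : b *m r = 0.
  by apply: (row_free_inj fio); rewrite /= mul0mx -mulmxA er mulmxA eb (exact_comp0 E).
apply/eqmxP; rewrite sub_kermx br eqxx /= -(submxMfree _ _ fm) eb -ep sub_kermx -mulmxA -er.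
by rewrite mulmxA mulmx_ker mul0mx.
Qed.

(** * The submodules M_j as tilting modules *)

Lemma largest_exists T : exists M (m : 'M[K]_(fdim M, fdim Q)), largest T m.
Proof. by have [M [m H]] := largest_dom L Phi T Q; exists M, m. Qed.

Lemma dom_empty M T : (forall z, ~~ T z) -> dom T M -> fdim M = 0%N.
Proof.
move=> T0 dM; apply/eqP; apply: contraT; rewrite -lt0n => M0.
have [S [c [sS hc fc]]] := simple_sub_exists M0.
have [z pz [f [hf ff fuf]]] := simple_label hL sS.
have [g [hg _ _ fg _]] := iso_inv hf ff fuf.
have := domL_inv hL pz (dom_mono (hom_comp hg hc) (row_free_mul fg fc) dM).
by rewrite (negPf (T0 z)).
Qed.

Lemma largest_bot M (m : 'M[K]_(fdim M, fdim Q)) : largest (trunc (l i).+1) m -> fdim M = 0%N.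
Proof. by move=> [_ _ dM _]; apply: (dom_empty _ dM) => z; rewrite /trunc ltnn. Qed.

Lemma largest_FN j M (m : 'M[K]_(fdim M, fdim Q)) :
  (1 <= j <= (l i).+1)%N -> largest (trunc j) m -> FN M.
Proof.
move: {2}((l i).+1 - j)%N (erefl ((l i).+1 - j)%N) => d.
elim: d j M m => [|d IH] j M m ed /andP [j1 jl] lm.
  have ej : j = (l i).+1 by apply/eqP; rewrite eqn_leq jl -subn_eq0 ed.
  by subst j; apply: filtered0; exact: largest_bot lm.
have jl' : (j <= l i)%N by rewrite -ltnS -subn_gt0 ed.
have [M' [m' lm']] := largest_exists (trunc j.+1).
have [||N [b [r [cN E _]]]] := truncation_step (j := j) _ lm lm'.
- by rewrite j1.
- by apply: (IH _ _ _ _ _ lm'); rewrite ?subnS ?ed // ltnS jl'.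
apply: (filteredS _ _ E); last by apply: (IH _ _ _ _ _ lm'); rewrite ?subnS ?ed // ltnS jl'.
by exists (i, j) => //; rewrite /inPhi /= hi j1.
Qed.

Lemma largest_top M (m : 'M[K]_(fdim M, fdim Q)) : largest (trunc 1) m -> row_full m.
Proof.
move=> lm; have [hm fm _ _] := lm.
have [C [p [hp fp ep]]] := quo_exists (hom_submod hm).
have E : exact3 m p by split=> //; exact: eqmx_sym.
have F1 : FN M by apply: (largest_FN (j := 1) _ lm).
have C0 := top_fdim0 lm F1 E.
by rewrite -sub1mx -ep sub_kermx mul1mx (fdim0_eq0 p C0) eqxx.
Qed.

Lemma largest_fdim_gt0 j M (m : 'M[K]_(fdim M, fdim Q)) :
  (1 <= j <= l i)%N -> largest (trunc j) m -> (0 < fdim M)%N.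
Proof.
move=> jj [hm fm dM maxM]; have [j1 jl] := andP jj.
have px : Phi (i, j) by rewrite /inPhi /= hi j1 jl.
have [N sN] := standard_exists le hL px.
have [f [hf f0]] := hull_hom_exists jj sN.
have dN : dom (trunc j) N by apply: (dom_sub _ (standard_dom hL px sN)) => z _; rewrite truncE.
have [h hh eh] := factor_mono hm fm hf (maxM _ _ dN hf).
rewrite lt0n; apply: contraNneq f0 => d0.
by rewrite -eh (fdim0_eq0 h d0) mul0mx.
Qed.

Lemma largest_indecomposable j M (m : 'M[K]_(fdim M, fdim Q)) :
  (1 <= j <= l i)%N -> largest (trunc j) m -> indecomposable M.
Proof.
move=> jj lm; have M0 := largest_fdim_gt0 jj lm; have [hm fm _ _] := lm.
split=> // U V hU hV _ UV0.
have [s' [hs' fs' _ Hs']] := hull_desc (simpleL hL Phi_bot) hs hm fm M0.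
have sub (W : 'M[K]_(fdim M)) : is_submod W -> \rank W != 0%N -> (s' <= W)%MS.
  move=> hW rW; have [S [g [hg fg eg]]] := sub_exists hW.
  by rewrite -eg; apply: Hs' => //; rewrite -mxrank_eq0 eg.
case: (eqVneq (\rank U) 0%N) => [|rU]; first by left.
case: (eqVneq (\rank V) 0%N) => [|rV]; first by right.
have : (s' <= U :&: V)%MS by rewrite sub_capmx !sub.
move/mxrankS; rewrite UV0 (eqP fs') leqNgt.
by rewrite (fdimL hL Phi_bot).
Qed.

Lemma compseries_le M k (c : nat -> 'M[K]_(fdim M)) : compseries M k c ->
  forall a b, (a <= b <= k)%N -> (c b <= c a)%MS.
Proof.
move=> [_ _ H] a; elim=> [|b IH] /andP [ab bk].
  by move: ab; rewrite leqn0 => /eqP ->.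
move: ab; rewrite leq_eqVlt => /orP [/eqP <- //|ab].
have [_ _ lt _] := H b bk.
by apply: submx_trans (ltmxW lt) (IH _); rewrite -ltnS ab ltnW.
Qed.

(** Each factor L_(i,j) of a composition series lifts to a map Delta(i,j) -> M whose image lies in
    one term but not in the next. All these images coincide, so only one position is possible. *)
Lemma largest_mult j M (m : 'M[K]_(fdim M, fdim Q)) :
  (1 <= j <= l i)%N -> largest (trunc j) m -> mult M (L (i, j)) 1.
Proof.
move=> jj lm; have [hm fm dM maxM] := lm; have [j1 jl] := andP jj.
have px : Phi (i, j) by rewrite /inPhi /= hi j1 jl.
have [N sN] := standard_exists le hL px.
have dN : dom (trunc j) N by apply: (dom_sub _ (standard_dom hL px sN)) => z _; rewrite truncE.
have dMb : dom (below (i, j)) M by apply: (dom_sub _ dM) => z _; rewrite truncE.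
have [t [ht ft Ht]] := standard_top hle hL px sN.
have same (f g : 'M[K]_(fdim N, fdim M)) : is_hom f -> is_hom g -> f != 0 -> g != 0 -> (f <= g)%MS.
  move=> hf hg f0 g0; rewrite -(submxMfree _ _ fm).
  by rewrite (hull_hom_image px sN (hom_comp hf hm) (hom_comp hg hm)) ?mul_neq0_free.
have [f [hf f0]] : exists f : 'M[K]_(fdim N, fdim M), is_hom f /\ f != 0.
  have [f [hf f0]] := hull_hom_exists jj sN.
  have [h hh eh] := factor_mono hm fm hf (maxM _ _ dN hf).
  by exists h; split=> //; apply: contraNneq f0 => e; rewrite -eh e mul0mx.
have [k [c [c0 ck H]]] := filtered_filt_by (simple_filtered M).
have cs : compseries M k c.
  by split=> // a /H [S sS sq]; exact: simple_sec_intro sS sq.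
pose P a := sq_iso M (c a) (c a.+1) (L (i, j)).
have Phom a : P a -> exists g : 'M[K]_(fdim N, fdim M), [/\ is_hom g, (g <= c a)%MS & ~~ (g <= c a.+1)%MS].
  move=> sq; have hU : is_submod (c a) by case: sq.
  have [S [g [hg fg eg]]] := sub_exists hU.
  have [q [hq fq ek]] := sq_isoP sq hg fg eg.
  have [h hh eh] := standard_lift hL px sN (dom_mono hg fg dMb) hq fq ht.
  exists (h *m g); split; [exact: hom_comp | by rewrite -eg submxMl|].
  rewrite -ek submxMfree // sub_kermx eh.
  by apply: row_full_neq0 ft; exact: (fdimL hL px).
have uniq a b : (a < k)%N -> (b < k)%N -> P a -> P b -> (a < b)%N -> False.
  move=> ak bk /Phom [g [hg _ ng]] /Phom [g' [hg' lg' ng']] ab.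
  have nz (u : 'M[K]_(fdim N, fdim M)) (W : 'M[K]_(fdim M)) : ~~ (u <= W)%MS -> u != 0.
    by apply: contraNneq => ->; rewrite sub0mx.
  have gg' := same g g' hg hg' (nz _ _ ng) (nz _ _ ng').
  case/negP: ng; apply: submx_trans gg' _.
  by apply: submx_trans lg' _; apply: (compseries_le cs); rewrite ab ltnW.
have [a ak Pa] : exists2 a, (a < k)%N & P a.
  (* At the position a where the image of f drops out of the series, f induces a nonzero map from
     Delta(i,j) to the simple factor, which identifies its label. *)
  have [a [ak fa nfa]] : exists a, [/\ (a < k)%N, (f <= c a)%MS & ~~ (f <= c a.+1)%MS].
    have nk : ~~ (f <= c k)%MS by rewrite ck submx0.
    have y0 : (f <= c 0%N)%MS by rewrite c0 submx1.
    elim: k nk {ck H cs uniq} => [|k IH] nk; first by rewrite y0 in nk.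
    case: (boolP (f <= c k)%MS) => [y|/IH [a [ak ? ?]]]; first by exists k.
    by exists a; split=> //; exact: ltnW.
  exists a => //; have [S sS sq] := H a ak.
  have hU : is_submod (c a) by case: sq.
  have [S' [g [hg fg eg]]] := sub_exists hU.
  have [q [hq fq ek]] := sq_isoP sq hg fg eg.
  have [|h hh eh] := factor_mono hg fg hf; first by rewrite eg.
  have [z pz [d [hd fd fud]]] := simple_label hL sS.
  have n0 : h *m q *m d != 0.
    by apply: mul_neq0_free => //; apply: contraNneq nfa => e; rewrite -ek -eh submxMfree // sub_kermx e.
  have ez := standard_homL px pz sN (hom_comp (hom_comp hh hq) hd) n0.
  rewrite /P ez; apply: (sq_iso_intro hg fg eg (hom_comp hq hd) (row_full_mul fq fud)).
  apply: eqmx_trans ek; apply: eqmxMr; apply/eqmxP.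
  rewrite !sub_kermx mulmxA mulmx_ker mul0mx eqxx /= -(mulmx_free_eq0 _ fd) -mulmxA mulmx_ker.
  by rewrite eqxx.
exists k, c, [set Ordinal ak]; split=> //; last by rewrite cards1.
move=> b; rewrite inE; split=> [/eqP -> //|Pb].
apply/eqP/val_inj => /=; case: (ltngtP b a) => // [ba|ab]; exfalso.
  exact: (uniq b a).
exact: (uniq a b).
Qed.

Lemma largest_tilting j M (m : 'M[K]_(fdim M, fdim Q)) :
  (1 <= j <= l i)%N -> largest (trunc j) m -> tilting L Phi le (i, j) M.
Proof.
move=> jj lm; have [hm fm dM _] := lm; have [j1 jl] := andP jj.
split.
- exact: filtered_filt_by (FD_sub hull_FD hm fm).
- by apply: filtered_filt_by; apply: (largest_FN (j := j) _ lm); rewrite j1 ltnW.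
- exact: largest_indecomposable lm.
- exact: largest_mult lm.
have sqM : sq_iso M (1%:M : 'M_(fdim M)) (0 : 'M_(fdim M)) M.
  apply: (sq_iso_bot_intro _ (@hom_1 _ _ M) _ (eqmx_refl _)).
  by rewrite /row_free mxrank1.
apply/(secfactorsP hL _ sqM); first by move=> y /andP [].
apply: (dom_sub _ dM) => z pz; rewrite truncE // => /andP [_ lz].
by rewrite pz /ltl lz /= orbN.
Qed.

(** * Uniqueness of the costandard filtration *)

Lemma costandard_dim x N N' : Phi x -> costandard x N -> costandard x N' -> fdim N = fdim N'.
Proof.
move=> px; suff G M M' : costandard x M -> costandard x M' -> (fdim M <= fdim M')%N.
  by move=> cN cN'; apply/eqP; rewrite eqn_leq !G.
move=> /(costandardP hL px) [P [a [f [[_ ha fa Ha] hf ff dM _]]]].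
move=> /(costandardP hL px) [R [b [g [[iR hb fb _] hg fg _ max]]]].
have [h [hh eh]] := iR _ _ a b ha fa hb.
have fh : row_free h by apply: Ha => //; rewrite eh; apply: row_free_neq0 fb; exact: (fdimL hL px).
have /mxrankS := max _ _ dM (hom_comp hf hh).
by rewrite (eqP fg) mxrankMfree // (eqP ff).
Qed.

Lemma costandard_socle x N : Phi x -> costandard x N ->
  exists c : 'M[K]_(fdim (L x), fdim N), is_hom c /\ row_free c.
Proof.
move=> px /(costandardP hL px) [P [a [f [[_ ha fa Ha] hf ff dM max]]]].
have [c hc ec] := factor_mono hf ff ha (max _ _ (domL hL px (below_refl hle px)) ha).
by exists c; split=> //; apply: (@row_free_mull _ _ _ _ _ f); rewrite ec.
Qed.

Lemma costandard_layer j y M M' (m : 'M[K]_(fdim M, fdim Q)) (m' : 'M[K]_(fdim M', fdim Q))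
  p1 p2 (U : 'M[K]_(p1, fdim Q)) (V : 'M[K]_(p2, fdim Q)) N :
  (1 <= j <= l i)%N -> largest (trunc j) m -> largest (trunc j.+1) m' ->
  Phi y -> costandard y N -> sq_iso Q U V N -> (V :=: m')%MS -> (U :=: m)%MS.
Proof.
move=> jj lm lm' py cN sq eV; have [j1 jl] := andP jj.
have px : Phi (i, j) by rewrite /inPhi /= hi j1 jl.
have FM' : FN M' by apply: (largest_FN (j := j.+1) _ lm'); rewrite /= ltnS.
have [N0 [b [r [cN0 Er ebm]]]] := truncation_step jj lm lm' FM'.
have [hm fm dM maxM] := lm; have [hm' fm' dM' maxM'] := lm'.
have [C [p [hp fp ep]]] := quo_exists (hom_submod hm').
have E : exact3 m' p by split=> //; exact: eqmx_sym.
have [c ihc] := quotient_hull jj lm' FM' E.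
have hU : is_submod U by case: sq.
have [S [g [hg fg eg]]] := sub_exists hU.
have [q [hq fq ek]] := sq_isoP sq hg fg eg.
have kqm : (kermx q *m g :=: m')%MS := eqmx_trans ek eV.
(* The embedding d of N = U/V into Q/M_(j+1) induced by the inclusion of U. *)
have [d hd ed] : exists2 d : 'M[K]_(fdim N, fdim C), is_hom d & q *m d = g *m p.
  apply: factor_epi => //; first exact: hom_comp.
  by apply/eqP; rewrite mulmxA -sub_kermx ep kqm.
have fd : row_free d.
  rewrite -kermx_eq0 -submx0.
  have [w ew] : exists w, kermx d = w *m q by apply/submxP; exact: submx_full.
  have : (w *m g <= kermx q *m g)%MS.
    by rewrite kqm -ep sub_kermx -mulmxA -ed mulmxA -ew mulmx_ker.
  by rewrite submxMfree // sub_kermx ew submx0.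
have [v [hv fv]] := costandard_socle py cN.
have hvd := hom_comp hv hd; have fvd := row_free_mul fv fd.
have cvd := hull_sub (simpleL hL px) ihc hvd (row_free_neq0 (fdimL hL py) fvd).
have [_ hc fc _] := ihc.
have [w hw ew] := factor_mono hvd fvd hc cvd.
have ey : (i, j) = y.
  apply: (homL hL px py hw); apply: contraTneq (row_free_neq0 (fdimL hL px) fc) => e.
  by rewrite -ew e mul0mx eqxx.
subst y.
have dN : dom (trunc j) N.
  have [? [? [? [_ _ _ dN _]]]] := costandardP hL px cN.
  by apply: (dom_sub _ dN) => z _; rewrite truncE.
have [Z [z Ez]] := exact_of_epi hq fq; have [hz fz _ _ ez] := Ez.
have [|z' hz' ez'] := factor_mono hm' fm' (hom_comp hz hg).
  by rewrite -kqm; apply: submxMr; rewrite ez.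
have fz' : row_free z' by apply: (@row_free_mull _ _ _ _ _ m'); rewrite ez' row_free_mul.
have dZ : dom (trunc j) Z.
  by apply: (dom_sub _ (dom_mono hz' fz' dM')) => ? _; exact: trunc_succ.
(* U lies in M_j because its factors are in [trunc j], and both have dimension dim M_(j+1) + dim
   nabla(i,j). *)
apply: eqmx_trans (eqmx_sym eg) _; apply/eqmxP; rewrite -mxrank_leqif_eq.
  rewrite (eqP fg) (eqP fm) (exact_dim Ez) (exact_dim Er) (costandard_dim px cN cN0).
  by rewrite eqn_add2r -(eqP fz) ez -(mxrankMfree _ fg) kqm (eqP fm').
by apply: maxM => //; exact: (dom_ext Ez).
Qed.

Lemma hull_tilting : tilting L Phi le (i, 1%N) Q.
Proof.
apply: (largest_tilting (m := 1%:M)); first by rewrite /= hl.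
have [M [m lm]] := largest_exists (trunc 1); have [hm fm dM maxM] := lm.
have fum := largest_top lm.
split; [exact: hom_1 | by rewrite /row_free mxrank1 | exact: dom_epi fum dM |].
by move=> X f _ _; exact: submx1.
Qed.

Lemma hull_chain : exists c : nat -> 'M[K]_(fdim Q),
  [/\ (c 1%N == 1%:M)%MS, \rank (c (l i).+1) = 0%N,
      forall j, (1 <= j <= l i)%N ->
        exists2 T : fmod B, tilting L Phi le (i, j) T & sq_iso Q (c j) (0 : 'M[K]_(fdim Q)) T,
      forall j, (1 <= j <= l i)%N ->
        exists2 N : fmod B, costandard (i, j) N & sq_iso Q (c j) (c j.+1) N &
      forall (k : nat) (d : nat -> 'M[K]_(fdim Q)),
        (d 1%N == 1%:M)%MS -> \rank (d k.+1) = 0%N ->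
        (forall j, (1 <= j <= k)%N -> exists y (N : fmod B),
           [/\ Phi y, costandard y N & sq_iso Q (d j) (d j.+1) N]) ->
        k = l i /\ (forall j, (1 <= j <= k.+1)%N -> (d j == c j)%MS)].
Proof.
have [j|c Hc] := functional_choice (fun j (U : 'M[K]_(fdim Q)) =>
  exists M (m : 'M[K]_(fdim M, fdim Q)), largest (trunc j) m /\ (m :=: U)%MS).
  have [M [m lm]] := largest_exists (trunc j); exists <<m>>%MS, M, m; split=> //.
  exact: eqmx_sym (genmxE m).
have c1 : (c 1%N :=: 1%:M)%MS.
  have [M [m [lm em]]] := Hc 1%N; apply: eqmx_trans (eqmx_sym em) _.
  by apply/eqmxP; rewrite submx1 sub1mx largest_top.
have clast : \rank (c (l i).+1) = 0%N.
  have [M [m [lm em]]] := Hc (l i).+1; have [_ fm _ _] := lm.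
  by rewrite -em (eqP fm) (largest_bot lm).
have layer j : (1 <= j <= l i)%N -> exists2 N : fmod B, costandard (i, j) N & sq_iso Q (c j) (c j.+1) N.
  move=> jj; have [M [m [lm em]]] := Hc j; have [M' [m' [lm' em']]] := Hc j.+1.
  have FM' : FN M'.
    by apply: (largest_FN (j := j.+1) _ lm'); case/andP: jj => _; rewrite /= ltnS.
  have [N [b [r [cN [hb fb hr fr eb] ebm]]]] := truncation_step jj lm lm' FM'.
  have [hm fm _ _] := lm.
  exists N => //; apply: (sq_iso_intro hm fm em hr fr).
  by apply: eqmx_trans em'; rewrite -ebm; apply: eqmxMr; exact: eqmx_sym.
have costandard_gt0 y N : Phi y -> costandard y N -> (0 < fdim N)%N.
  move=> py cN; have [v [_ /eqP fv]] := costandard_socle py cN.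
  by apply: leq_trans (fdimL hL py) _; rewrite -fv; exact: rank_leq_col.
have rank_layer p1 p2 (U : 'M[K]_(p1, fdim Q)) (V : 'M[K]_(p2, fdim Q)) y N :
    Phi y -> costandard y N -> sq_iso Q U V N -> (\rank V < \rank U)%N.
  move=> py cN [_ _ _ [_ [_ _ _ ->]]].
  by rewrite -addn1 leq_add2l; exact: costandard_gt0 cN.
exists c; split=> //; first exact/eqmxP.
  move=> j jj; have [M [m [lm em]]] := Hc j; have [hm fm _ _] := lm.
  exists M; first exact: largest_tilting lm.
  exact: (sq_iso_bot_intro _ hm fm em).
move=> k d /eqmxP d1 dk Hd.
(* The two chains are compared from the bottom, where a layers have been passed, because their
   lengths k and l i are not yet known to agree. *)
have G a : (a <= k)%N -> (a <= l i)%N -> (d (k.+1 - a)%N :=: c ((l i).+1 - a)%N)%MS.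
  elim: a => [_ _|a IH ak al].
    rewrite !subn0; apply/eqmxP.
    have /eqP -> : d k.+1 == 0 by rewrite -mxrank_eq0 dk.
    have /eqP -> : c (l i).+1 == 0 by rewrite -mxrank_eq0 clast.
    by rewrite !sub0mx.
  have IH' := IH (ltnW ak) (ltnW al); rewrite !subSS.
  have ek : (k.+1 - a)%N = (k - a).+1 by rewrite subSn // ltnW.
  have el : ((l i).+1 - a)%N = (l i - a).+1 by rewrite subSn // ltnW.
  have [|y [N [py cN sq]]] := Hd (k - a)%N; first by rewrite subn_gt0 ak leq_subr.
  rewrite ek el in IH'.
  have [M [m [lm em]]] := Hc (l i - a)%N; have [M' [m' [lm' em']]] := Hc (l i - a).+1.
  apply: eqmx_trans em; apply: (costandard_layer _ lm lm' py cN sq).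
    by rewrite subn_gt0 al leq_subr.
  exact: eqmx_trans IH' (eqmx_sym em').
(* Whichever chain is shorter, it has reached Q while the other still has a layer to come; that
   layer is nonzero and would exceed dim Q. *)
have ekl : k = l i.
  case: (ltngtP k (l i)) => // [kl|lk].
    have := G k (leqnn k) (ltnW kl); rewrite subSnn => ec.
    have jj : (1 <= l i - k <= l i)%N by rewrite subn_gt0 kl leq_subr.
    have [N cN sq] := layer _ jj.
    have pj : Phi (i, (l i - k)%N) by rewrite /inPhi /= hi.
    have := rank_layer _ _ _ _ _ _ pj cN sq.
    rewrite -subSn ?(ltnW kl) // -ec d1 mxrank1 ltnNge.
    by rewrite rank_leq_col.
  have := G (l i) (ltnW lk) (leqnn _); rewrite subSnn => ed.
  have [|y [N [py cN sq]]] := Hd (k - l i)%N; first by rewrite subn_gt0 lk leq_subr.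
  have := rank_layer _ _ _ _ _ _ py cN sq.
  by rewrite -subSn ?(ltnW lk) // ed c1 mxrank1 ltnNge rank_leq_col.
split=> // j /andP [j1 jk]; apply/eqmxP.
have := G (k.+1 - j)%N; rewrite -ekl !subKn //; apply.
  by rewrite leq_subLR -[k.+1]add1n leq_add2r.
by rewrite leq_subLR -[k.+1]add1n leq_add2r.
Qed.

Lemma hull_sequence j : (1 <= j <= l i)%N ->
  exists (T T' N : fmod B) (f : 'M[K]_(fdim T', fdim T)),
    [/\ tilting L Phi le (i, j) T,
        (if (j < l i)%N then tilting L Phi le (i, j.+1) T' else fdim T' = 0%N),
        costandard (i, j) N,
        is_hom f /\ row_free f &
        sq_iso T (1%:M : 'M[K]_(fdim T)) f N].
Proof.
move=> jj; have [M [m lm]] := largest_exists (trunc j).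
have [M' [m' lm']] := largest_exists (trunc j.+1).
have FM' : FN M'.
  by apply: (largest_FN (j := j.+1) _ lm'); case/andP: jj => _; rewrite /= ltnS.
have [N [b [r [cN [hb fb hr fr eb] _]]]] := truncation_step jj lm lm' FM'.
exists M, M', N, b; split=> //.
- exact: largest_tilting lm.
- case: ltnP => [jl|lj]; first exact: largest_tilting lm'.
  have ej : j = l i by apply/eqP; rewrite eqn_leq lj; case/andP: jj => _ ->.
  by subst j; exact: largest_bot lm'.
exact: (sq_iso_top_intro hr fr (eqmx_sym eb)).
Qed.

End Hull.

End UltraStrong.

Theorem theorem5p5 (K : fieldType) (B : falgType K) (n : nat) (l : nat -> nat)
  (le : rel lab) (L : lab -> fmod B) :
  (* the labelling Phi = {(i,j) : 1 <= i <= n, 1 <= j <= l i} *)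
  (forall i, 1 <= i <= n -> 0 < l i) ->
  poset_on (inPhi n l) le ->
  simples_labelled L (inPhi n l) ->
  (* B is ultra strongly quasihereditary w.r.t. (Phi, le) *)
  ultra_strongly_qh L (inPhi n l) le ->
  (* labelling conventions of the context *)
  (forall i j, inPhi n l (i, j) -> j < l i -> ltl le (i, j.+1) (i, j)) ->
  (forall i j, inPhi n l (i, j) -> j < l i ->
     forall (N : fmod B) (R : 'M[K]_(fdim N)) (N' : fmod B),
       standard L (inPhi n l) le (i, j) N -> is_rad R ->
       standard L (inPhi n l) le (i, j.+1) N' ->
       sq_iso N R (0 : 'M[K]_(fdim N))%R N') ->
  (forall i (N : fmod B), 1 <= i <= n ->
     standard L (inPhi n l) le (i, l i) N -> iso N (L (i, l i))) ->
  forall i, 1 <= i <= n ->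
  [/\
   (* Q_{i,l_i} is isomorphic to T(i,1) *)
   forall Q : fmod B, injhull L (i, l i) Q -> tilting L (inPhi n l) le (i, 1) Q,
   (* short exact sequences 0 -> T(i,j+1) -> T(i,j) -> nabla(i,j) -> 0,
      with T(i, l_i + 1) := 0 *)
   forall j, 1 <= j <= l i ->
     exists (T T' N : fmod B) (f : 'M[K]_(fdim T', fdim T)),
       [/\ tilting L (inPhi n l) le (i, j) T,
           (if j < l i then tilting L (inPhi n l) le (i, j.+1) T'
            else fdim T' = 0),
           costandard L (inPhi n l) le (i, j) N,
           is_hom f /\ row_free f &
           sq_iso T (1%:M : 'M[K]_(fdim T))%R f N] &
   (* the chain of submodules of Q_{i,l_i}, and its uniqueness *)
   forall Q : fmod B, injhull L (i, l i) Q ->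
     exists c : nat -> 'M[K]_(fdim Q),
       [/\ (c 1 == (1%:M)%R)%MS, \rank (c (l i).+1) = 0,
           forall j, 1 <= j <= l i ->
             exists2 T : fmod B, tilting L (inPhi n l) le (i, j) T &
               sq_iso Q (c j) (0 : 'M[K]_(fdim Q))%R T,
           forall j, 1 <= j <= l i ->
             exists2 N : fmod B, costandard L (inPhi n l) le (i, j) N &
               sq_iso Q (c j) (c j.+1) N &
           (* uniqueness among filtrations with costandard quotients *)
           forall (k : nat) (d : nat -> 'M[K]_(fdim Q)),
             (d 1 == (1%:M)%R)%MS -> \rank (d k.+1) = 0 ->
             (forall j, 1 <= j <= k ->
                exists y (N : fmod B), [/\ inPhi n l y,
                  costandard L (inPhi n l) le y N & sq_iso Q (d j) (d j.+1) N]) ->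
             k = l i /\ (forall j, 1 <= j <= k.+1 -> (d j == c j)%MS)]].
Proof.
move=> hl hle hL husq hlt hrad hbase i hi.
have px : inPhi n l (i, l i) by rewrite /inPhi /= hi leqnn hl.
(* The exact sequences are claimed without any given hull, so one is constructed for them. *)
have [Q0 [s0 hs0]] := ihull_exists (simpleL hL px).
split.
- move=> Q /(injhullP hL px) [s hs].
  exact: (hull_tilting hl hle hL husq hlt hrad hbase hi hs).
- exact: (hull_sequence hl hle hL husq hlt hrad hbase hi hs0).
move=> Q /(injhullP hL px) [s hs].
exact: (hull_chain hl hle hL husq hlt hrad hbase hi hs).
Qed.
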